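(* Let $A=\{1,\dots,|A|\}$ be a finite set, $n\ge 1$, and $R\subseteq A^{2n+1}$. Then at least one of the following conditions holds: (1) there exists a $\mathbf z$-parameterized nonempty 1-consistent reduction for $\mathcal I_R$; (2) there exists a subinstance $\mathcal J\subseteq\mathcal I_R$ (a subset of the constraints) with at most $$(n\cdot |A|)^{2^{\left(2\cdot|A|^{|A|+1}\right)}}$$ variables such that $\mathcal J$ has no solution for some $\mathbf z\in A^{|A|}$; (3) there exists a mighty tuple III q-definable from $R$.
   Context: q-definability: a relation $P\subseteq A^r$ is q-definable from a set $\Sigma$ of relations on $A$ (or from $R$, meaning $\Sigma=\{R\}$) if it is defined by a formula with free variables among $v_1,\dots,v_r$ consisting of a prefix of quantifiers $\forall,\exists$ over $A$ followed by a finite, possibly empty, conjunction of atoms over relations of $\Sigma$. A tuple of relations is q-definable if each member is. The instance $\mathcal I_R$: write $R(y_0,\dots,y_n,x_1,\dots,x_n)$. For $0\le m\le n-1$ put $$\mathcal S_R^{m}(y_0,\dots,y_m,x_1,\dots,x_m)=\forall x\,\exists y_{m+1}\forall x'\,\exists y_{m+2}\dots\exists y_{n}\;R(y_0,\dots,y_n,x_1,\dots,x_m,x,x',\dots,x'),$$ and $\mathcal S_R^{n}=R$. $\mathcal I_R$ is the CSP instance with variables $y_m^{a_1,\dots,a_m}$ ($0\le m\le n$, $a_1,\dots,a_m\in A$; for $m=0$ the single variable $y_0$), with external parameters $\mathbf z=(z_1,\dots,z_{|A|})\in A^{|A|}$ (not counted as variables), and with one constraint $\mathcal S_R^m(y_0,y_1^{a_1},y_2^{a_1,a_2},\dots,y_m^{a_1,\dots,a_m},z_{a_1},\dots,z_{a_m})$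 for each $m\in\{0,\dots,n\}$ and $a_1,\dots,a_m\in A$. For each fixed $\mathbf z$ it is an ordinary CSP instance over $A$. Reductions: a $\mathbf z$-parameterized unary relation is a subset $U\subseteq A^{|A|+1}$, with ${}^{\mathbf z}U=\{a:(\mathbf z,a)\in U\}$. A $\mathbf z$-parameterized reduction $D^{(\top)}$ assigns a $\mathbf z$-parameterized unary relation $D_u^{(\top)}$ to each variable $u$ of $\mathcal I_R$. It is nonempty if ${}^{\mathbf z}D_u^{(\top)}\ne\varnothing$ for all $u$ and $\mathbf z$. It is 1-consistent if for every $\mathbf z$, every constraint on variables $u_1,\dots,u_s$ with constraint relation ${}^{\mathbf z}P\subseteq A^s$, and every $i$, the projection of ${}^{\mathbf z}P\cap({}^{\mathbf z}D_{u_1}^{(\top)}\times\dots\times{}^{\mathbf z}D_{u_s}^{(\top)})$ onto the $i$-th coordinate equals ${}^{\mathbf z}D_{u_i}^{(\top)}$. Notation: a $(\mathbf z,\alpha)$-parameterized binary relation is $Q\subseteq A^{|A|+m+2}$ with $m\ge1$; ${}^{\mathbf z}Q^{\alpha}=\{(a,b):(\mathbf z,\alpha,a,b)\in Q\}$ for $\alpha\in A^m$; ${}^{\mathbf z}Q^{\forall}=\bigcap_{x\in A}{}^{\mathbf z}Q^{x,\dots,x}$, ${}^{\mathbf z}Q^{\forall\forall}=\bigcap_{\alpha\in A^m}{}^{\mathbf z}Q^{\alpha}$. For unary $U$ and binary $S$: $U+S=\{y:\exists x\,(U(x)\wedge S(x,y))\}$ and $S+U=\{x:\exists y\,(S(x,y)\wedge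 U(y))\}$. Mighty tuple III: a tuple $(Q,B,C)$ with $Q$ a $(\mathbf z,\alpha)$-parameterized binary relation and $B,C$ $\mathbf z$-parameterized unary relations such that: 1. ${}^{\mathbf z}B\ne\varnothing$ and ${}^{\mathbf z}C\neq\varnothing$ for every $\mathbf z$; 2. ${}^{\mathbf z}B+{}^{\mathbf z}Q^{\forall\forall}={}^{\mathbf z}B$ for every $\mathbf z$; 3. ${}^{\mathbf z}Q^{\forall\forall}+{}^{\mathbf z}C={}^{\mathbf z}C$ for every $\mathbf z$; 4. ${}^{\mathbf z}Q^{\forall}\cap({}^{\mathbf z}B\times{}^{\mathbf z}C)\ne\varnothing$ for every $\mathbf z$; 5. ${}^{\mathbf z}B\cap{}^{\mathbf z}C=\varnothing$ for some $\mathbf z\in A^{|A|}$. *)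

(* Defs.v *)
From mathcomp Require Import all_boot.

Set Implicit Arguments.
Unset Strict Implicit.
Unset Printing Implicit Defensive.

(* The domain A is 'I_k, so that A^|A| is the type k.-tuple 'I_k and the
   parameter z_a is tnth z a.  Relations of arity r are sets of r-tuples;
   [holds P s] lets an argument list s be assembled by concatenation, and is
   false when s does not have length r. *)
Definition holds (A : finType) (r : nat) (P : {set r.-tuple A}) (s : seq A)
  : bool := [exists t in P, tval t == s].

(* q-definability *)

(* Prenex formulas over one relation symbol of arity s, well scoped by
   construction: [qformula s m] has its free variables among v_0, ..., v_(m-1),
   a quantifier binds the variable with the next index m, and the innermost
   part is a possibly empty conjunction of atoms.  Equality is not an atom. *)
Inductive qformula (s : nat) : nat -> Type :=
| QConj m of seq (s.-tuple 'I_m) : qformula s m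
| QForall m of qformula s m.+1 : qformula s m
| QExists m of qformula s m.+1 : qformula s m.

Fixpoint qsat (A : finType) (s : nat) (R : {set s.-tuple A}) (m : nat)
    (phi : qformula s m) : m.-tuple A -> bool :=
  match phi in qformula _ m return m.-tuple A -> bool with
  | QConj _ atoms => fun e => all (fun v => map_tuple (tnth e) v \in R) atoms
  | QForall _ psi => fun e => [forall a, qsat R psi [tuple of rcons e a]]
  | QExists _ psi => fun e => [exists a, qsat R psi [tuple of rcons e a]]
  end.

Definition q_definable (A : finType) (s r : nat)
    (R : {set s.-tuple A}) (P : {set r.-tuple A}) : Prop :=
  exists phi : qformula s r, forall t : r.-tuple A, (t \in P) = qsat R phi t.

(* CSP instances with external parameters *)

Record pconstraint (k : nat) (V : Type) := PConstraint {
  carity : nat;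
  cscope : carity.-tuple V;
  crel : k.-tuple 'I_k -> {set carity.-tuple 'I_k}
}.

(* An instance is a family of constraints C indexed by a finite type I; a
   subinstance is a set of indices, whose variables are those occurring in one
   of its constraints. *)
Definition inst_vars (k : nat) (V I : finType) (C : I -> pconstraint k V)
    (J : {set I}) : {set V} :=
  \bigcup_(c in J) [set u in cscope (C c)].

Definition is_solution (k : nat) (V I : finType) (C : I -> pconstraint k V)
    (J : {set I}) (z : k.-tuple 'I_k) (f : V -> 'I_k) : Prop :=
  forall c, c \in J -> map_tuple f (cscope (C c)) \in crel (C c) z.

Definition zsect (k : nat) (U : {set k.+1.-tuple 'I_k}) (z : k.-tuple 'I_k)
  : {set 'I_k} := [set a | holds U (rcons z a)].

Definition nonempty_reduction (k : nat) (V : finType)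
    (D : V -> {set k.+1.-tuple 'I_k}) : Prop :=
  forall (u : V) (z : k.-tuple 'I_k), zsect (D u) z != set0.

Definition one_consistent (k : nat) (V I : finType) (C : I -> pconstraint k V)
    (D : V -> {set k.+1.-tuple 'I_k}) : Prop :=
  forall (z : k.-tuple 'I_k) (c : I) (i : 'I_(carity (C c))),
    [set tnth t i | t in [set t in crel (C c) z |
       [forall j, tnth t j \in zsect (D (tnth (cscope (C c)) j)) z]]]
    = zsect (D (tnth (cscope (C c)) i)) z.

(* The instance I_R *)

(* For m < n the x' after x is repeated n - m.+1 times, so that when m = n - 1
   the quantifier over x' is vacuous; w stands for y_(m+2), ..., y_n. *)
Definition SR (n k : nat) (R : {set (2 * n).+1.-tuple 'I_k}) (m : nat)
    (ys : m.+1.-tuple 'I_k) (xs : m.-tuple 'I_k) : bool :=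
  if m < n then
    [forall x : 'I_k, exists y : 'I_k, forall x' : 'I_k,
     exists w : (n - m.+1).-tuple 'I_k,
       holds R (ys ++ y :: w ++ xs ++ x :: nseq (n - m.+1) x')]
  else holds R (ys ++ xs).

(* The bounded sequence [:: a_1; ...; a_m] : n.-bseq 'I_k names both the
   variable y_m^{a_1,...,a_m} and the constraint
   S_R^m(y_0, y_1^{a_1}, ..., y_m^{a_1,...,a_m}, z_{a_1}, ..., z_{a_m}). *)
Definition IR (n k : nat) (R : {set (2 * n).+1.-tuple 'I_k})
    (s : n.-bseq 'I_k) : pconstraint k (n.-bseq 'I_k) :=
  @PConstraint k (n.-bseq 'I_k) (size s).+1
    [tuple [bseq of take j s] | j < (size s).+1]
    (fun z => [set ys | SR R ys (map_tuple (tnth z) (in_tuple s))]).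

(* Mighty tuples III *)

Definition Qsect (k m : nat) (Q : {set (k + m + 2).-tuple 'I_k})
    (z : k.-tuple 'I_k) (al : m.-tuple 'I_k) : {set 'I_k * 'I_k} :=
  [set ab | holds Q (z ++ al ++ [:: ab.1; ab.2])].

Definition Qall (k m : nat) (Q : {set (k + m + 2).-tuple 'I_k})
    (z : k.-tuple 'I_k) : {set 'I_k * 'I_k} :=
  \bigcap_(x : 'I_k) Qsect Q z (nseq_tuple m x).

Definition Qallall (k m : nat) (Q : {set (k + m + 2).-tuple 'I_k})
    (z : k.-tuple 'I_k) : {set 'I_k * 'I_k} :=
  \bigcap_(al : m.-tuple 'I_k) Qsect Q z al.

(* U + S and S + U *)
Definition add_fwd (A : finType) (U : {set A}) (S : {set A * A}) : {set A} :=
  [set y | [exists x, (x \in U) && ((x, y) \in S)]].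

Definition add_bwd (A : finType) (S : {set A * A}) (U : {set A}) : {set A} :=
  [set x | [exists y, ((x, y) \in S) && (y \in U)]].

Record mighty_tuple_III (k m : nat) (Q : {set (k + m + 2).-tuple 'I_k})
    (B C : {set k.+1.-tuple 'I_k}) : Prop := MightyTupleIII {
  mtIII_nonempty : forall z, zsect B z != set0 /\ zsect C z != set0;
  mtIII_B : forall z, add_fwd (zsect B z) (Qallall Q z) = zsect B z;
  mtIII_C : forall z, add_bwd (Qallall Q z) (zsect C z) = zsect C z;
  mtIII_meet : forall z,
    Qall Q z :&: setX (zsect B z) (zsect C z) != set0;
  mtIII_disjoint : exists z, zsect B z :&: zsect C z = set0
}.

(* Main.v *)
Require Import Defs.
From mathcomp Require Import all_boot zify.

(* Run the arc consistency algorithm on the instance at the identity parameter,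
   always enforcing the constraints of least depth that are still violated.  If
   it stabilizes with nonempty domains, these form the reduction.  If a domain is
   emptied by a derivation of depth less than N = 2 ^ (2 * k ^ k.+1), only few
   variables are involved.  Otherwise a hybrid argument, replacing shallow domains
   by final ones one at a time, yields a chain of N - 1 links along which forward
   sets B_i and backward sets C_i are carried, with B_i and C_i always nonempty
   but disjoint at one parameter.  By pigeonhole the pair (B, C) repeats, and the
   composite of the links in between is the relation Q, whose parameters alpha
   are the values over which the universal quantifiers at depth at least j range.
   Taking all values gives back the links, so the intersection over all alpha
   preserves B and C.  For constant alpha, the domains just before a step at
   depth j are consistent for the relaxed constraints: a solution of S^(j-1)
   supplies the missing y_j, ..., y_n.  Hence B and C are then connected. *)

(** The exponent base N counts the pairs of subsets of A^(k+1), since [2 ^ (2 * k ^ k.+1)] is the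
    square of [2 ^ (k ^ k.+1)]. Disjointness of B and C at a common parameter leaves at most half of
    these pairs. On the other hand, a single link may resist being crossed for constant alpha,
    whereas two consecutive links never do, so only every second position of the chain is used. The
    two factors of 2 cancel, and N - 1 links suffice. A derivation of depth N - 1 needs at most 1 +
    nk + ... + (nk)^(N-1) variables, which is below (nk)^N once nk > 1.

    A parameter z merely renames labels: the domain of y^u at z is the domain at the identity of the
    variable whose label is the image of u. One run of the algorithm thus serves every z.

    Definability shapes the links. Neither equality nor implication is available, so quantification
    over the values of alpha is written as a finite conjunction, and a link must have its source and
    target at different positions of its path, to be substituted separately. *)

Set Implicit Arguments.
Unset Strict Implicit.
Unset Printing Implicit Defensive.

(** * Arc consistency *)

Section ArcConsistency.

Variables (A : finType) (a0 : A) (n : nat) (R : {set (2 * n).+1.-tuple A}).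

Implicit Types (rho : nat -> {set A}) (S : nat -> seq A -> {set A})
  (u w x y : seq A) (lev : nat -> nat) (G : seq A -> {set A}).

(* [rho i] is the range of the quantified label x_(i+1); [whole] gives S_R^m. *)
Definition whole : nat -> {set A} := fun=> setT.

Definition rSR rho i (ys xs : seq A) : bool :=
  if i < n then
    [forall x in rho i, exists y, [forall x' in rho i.+1,
     exists v : (n - i.+1).-tuple A,
       holds R (ys ++ y :: v ++ xs ++ x :: nseq (n - i.+1) x')]]
  else holds R (ys ++ xs).

(* All the constraints on the path from the root to y^w: with the prefixes
   included, a value supported at depth j is supported at every smaller depth. *)
Definition path_sat rho w y : bool :=
  [forall i : 'I_(size w).+1, rSR rho i (take i.+1 y) (take i w)].

(** [S] depends on the position as well as on the word, so that final, shallow and singleton sets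
    can be mixed along one path. *)
Definition supported rho S w i a : bool :=
  [exists y : (size w).+1.-tuple A, [&& nth a0 y i == a, path_sat rho w y &
     [forall j : 'I_(size w).+1, nth a0 y j \in S j (take j w)]]].

Fixpoint all_ext rho r u (F : seq A -> bool) : bool :=
  if r is r'.+1 then
    [forall x in rho (size u), all_ext rho r' (rcons u x) F]
  else F u.

(* The domain of y^u at the identity parameter once the constraints of depths
   lev 0, ..., lev (t - 1) have been enforced in turn, as far as derivations of
   depth at most d can tell.  Labels below u range over rho. *)
Fixpoint acons rho lev t d u : {set A} :=
  match t, d with
  | t'.+1, d'.+1 =>
      [set a in acons rho lev t' d u | (lev t' < size u) ||
         all_ext rho (lev t' - size u) u
           (fun w => supported rho (fun=> acons rho lev t' d') w (size u) a)]
  | _, _ => setT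
  end.

Definition dom lev t := acons whole lev t t.

Definition stable_at j G : Prop :=
  forall w i a, size w = j -> i <= j -> a \in G (take i w) ->
    supported whole (fun=> G) w i a.

Lemma supportedP rho S w i a :
  reflect (exists y, [/\ size y = (size w).+1, nth a0 y i = a, path_sat rho w y &
             forall j, j <= size w -> nth a0 y j \in S j (take j w)])
          (supported rho S w i a).
Proof.
apply: (iffP existsP) => [[y /and3P[/eqP yi yw /forallP yS]]|[y [sy yi yw yS]]].
  exists y; split=> //; first exact: size_tuple.
  by move=> j jw; apply: (yS (Ordinal (_ : j < (size w).+1))).
have sy' : size y == (size w).+1 by apply/eqP.
exists (Tuple sy'); rewrite /= yi eqxx yw /=; apply/forallP => j.
exact/yS/(leq_ord j).
Qed.

Lemma path_satP rho w y :
  reflect (forall i, i <= size w -> rSR rho i (take i.+1 y) (take i w))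
          (path_sat rho w y).
Proof.
apply: (iffP forallP) => [H i iw|H i]; last exact/H/(leq_ord i).
exact: (H (Ordinal (_ : i < (size w).+1))).
Qed.

Lemma path_sat_take rho w y i :
  i <= size w -> path_sat rho w y -> path_sat rho (take i w) (take i.+1 y).
Proof.
move=> iw /path_satP H; apply/path_satP => j; rewrite size_takel // => ji.
rewrite !take_takel ?ltnS //; apply: H; exact: leq_trans iw.
Qed.

Lemma all_extP rho r u (F : seq A -> bool) :
  reflect (forall x, size x = r ->
             (forall i, i < r -> nth a0 x i \in rho (size u + i)) -> F (u ++ x))
          (all_ext rho r u F).
Proof.
elim: r u => [|r IH] u /=.
  apply: (iffP idP) => [Fu x /size0nil -> _|H]; first by rewrite cats0.
  by rewrite -[u]cats0; apply: H.
apply: (iffP forallP) => [H [//|b x] [sx] xr|H b].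
  have /implyP/(_ _)/IH := H b.
  have /[swap]/[apply] : b \in rho (size u) by have := xr 0 isT; rewrite addn0.
  rewrite -cat_rcons; apply=> // i ir; rewrite size_rcons addSnnS.
  exact: (xr i.+1).
apply/implyP => bu; apply/IH => x sx xr; rewrite cat_rcons.
apply: H => /=; first by rewrite sx.
case=> [|i] ir /=; first by rewrite addn0.
by have := xr i ir; rewrite size_rcons addSnnS.
Qed.

Lemma acons0 rho lev t u : acons rho lev t 0 u = setT.
Proof. by case: t. Qed.

Lemma aconsS rho lev t d u a :
  reflect (a \in acons rho lev t d.+1 u /\
    forall w, size w = lev t -> size u <= size w -> take (size u) w = u ->
      (forall i, size u <= i < size w -> nth a0 w i \in rho i) ->
      supported rho (fun=> acons rho lev t d) w (size u) a)
   (a \in acons rho lev t.+1 d.+1 u).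
Proof.
rewrite /= inE; apply: (iffP andP) => -[aP H]; split=> //.
  move=> w sw uw wu wr; case/orP: H; first by lia.
  have ew : u ++ drop (size u) w = w by rewrite -{1}wu cat_take_drop.
  move/all_extP => /(_ (drop (size u) w)); rewrite ew.
  apply; first by rewrite size_drop sw.
  move=> i ir; rewrite nth_drop; apply: wr; lia.
case: ltnP => //= uw; apply/all_extP => x sx xr.
apply: H; rewrite ?size_cat ?sx ?take_size_cat //; [lia..|].
move=> i /andP[ui iw]; rewrite nth_cat ltnNge ui /=.
have -> : i = size u + (i - size u) by lia.
rewrite addKn; apply: xr; lia.
Qed.

(** Fewer labels to quantify over make every constraint weaker, so more values survive. All
    antitonicity in [rho] below rests on this. *)
Lemma rSR_anti rho rho' i ys xs :
  (forall i, rho i \subset rho' i) -> rSR rho' i ys xs -> rSR rho i ys xs.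
Proof.
move=> sr; rewrite /rSR; case: ifP => // _ /forall_inP H.
apply/forall_inP => x xr; have /existsP[y Hy] := H x (subsetP (sr _) _ xr).
apply/existsP; exists y; apply/forall_inP => x' xr'.
exact: (forall_inP Hy _ (subsetP (sr _) _ xr')).
Qed.

Lemma path_sat_anti rho rho' w y :
  (forall i, rho i \subset rho' i) -> path_sat rho' w y -> path_sat rho w y.
Proof.
by move=> sr /path_satP H; apply/path_satP => i /H; apply: rSR_anti.
Qed.

Lemma supported_mono rho rho' S S' w i a :
  (forall i, rho i \subset rho' i) ->
  (forall j, j <= size w -> S' j (take j w) \subset S j (take j w)) ->
  supported rho' S' w i a -> supported rho S w i a.
Proof.
move=> sr sS /supportedP[y [sy yi yw yS]]; apply/supportedP; exists y.
split=> //; first exact: path_sat_anti yw.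
by move=> j jw; apply: (subsetP (sS j jw)); apply: yS.
Qed.

Lemma acons_anti rho rho' lev t d u :
  (forall i, rho i \subset rho' i) ->
  acons rho' lev t d u \subset acons rho lev t d u.
Proof.
move=> sr; elim: t d u => [|t IH] [|d] u; try by rewrite ?acons0 subsetT.
apply/subsetP => a /aconsS[aP H]; apply/aconsS; split.
  exact: (subsetP (IH _ _)).
move=> w sw uw wu wr.
have /supported_mono : supported rho' (fun=> acons rho' lev t d) w (size u) a.
  by apply: H => // i iw; apply: (subsetP (sr i)); apply: wr.
by apply.
Qed.

Lemma acons_decd rho lev t d u : acons rho lev t d.+1 u \subset acons rho lev t d u.
Proof.
elim: t d u => [|t IH] [|d] u; try by rewrite ?acons0 subsetT.
apply/subsetP => a /aconsS[aP H]; apply/aconsS; split.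
  exact: (subsetP (IH _ _)).
by move=> w sw uw wu wr; apply: supported_mono (H w sw uw wu wr).
Qed.

Lemma acons_led rho lev t d d' u :
  d <= d' -> acons rho lev t d' u \subset acons rho lev t d u.
Proof.
move/subnK <-; elim: (d' - d) => // e IH.
by rewrite addSn; apply: subset_trans (acons_decd _ _ _ _ _) IH.
Qed.

Lemma acons_let rho lev t t' d u :
  t <= t' -> acons rho lev t' d u \subset acons rho lev t d u.
Proof.
move/subnK <-; elim: (t' - t) => // e IH; rewrite addSn.
apply: subset_trans IH; case: d => [|d]; first by rewrite !acons0.
by apply/subsetP => a /aconsS[].
Qed.

(** Each level of a derivation refers to a strictly earlier step, so no derivation up to time t is
    deeper than t. *)
Lemma acons_deep rho lev t d u : t <= d -> acons rho lev t d u = acons rho lev t t u.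
Proof.
elim: t d u => [|t IH] [|d] u // td.
have eqS e w : t <= e -> acons rho lev t e w = acons rho lev t t w by apply: IH.
apply/setP => a.
apply/aconsS/aconsS => -[aP H]; split; try by rewrite eqS // in aP *; lia.
- by rewrite (eqS t.+1) // -(eqS d.+1) //; lia.
- move=> w sw uw wu wr; apply: supported_mono (H w sw uw wu wr) => // j _.
  by rewrite eqS.
- by rewrite (eqS d.+1) -1?(eqS t.+1) //; lia.
move=> w sw uw wu wr; apply: supported_mono (H w sw uw wu wr) => // j _.
by rewrite (eqS d).
Qed.

Lemma dom_le lev t t' u : t <= t' -> dom lev t' u \subset dom lev t u.
Proof.
move=> tt; apply: subset_trans (acons_let _ _ _ _ tt) _.
by rewrite acons_deep.
Qed.

Lemma dom_acons lev t t' d u : t' <= t -> dom lev t u \subset acons whole lev t' d u.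
Proof.
move=> tt; apply: subset_trans (acons_let _ _ _ _ tt) _; rewrite /dom.
have [td|dt] := leqP t d; first by rewrite !acons_deep ?subxx //; lia.
by apply: acons_led; apply: ltnW.
Qed.

Lemma domS lev t u a :
  reflect (a \in dom lev t u /\
    forall w, size w = lev t -> size u <= size w -> take (size u) w = u ->
      supported whole (fun=> dom lev t) w (size u) a)
   (a \in dom lev t.+1 u).
Proof.
apply: (iffP (aconsS _ _ _ _ _ _)); rewrite /dom (@acons_deep _ _ _ t.+1) //.
  by move=> [aP H]; split=> // w sw uw wu; apply: H => // i _; rewrite inE.
by move=> [aP H]; split=> // w sw uw wu _; apply: H.
Qed.

Lemma acons_supported lev t d u a tau w :
  a \in acons whole lev t d.+1 u -> tau < t -> size w = lev tau ->
  size u <= size w -> take (size u) w = u ->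
  supported whole (fun=> acons whole lev tau d) w (size u) a.
Proof.
move=> aP tt sw uw wu; have /aconsS[_] := subsetP (acons_let _ _ _ _ tt) _ aP.
by apply=> // i _; rewrite inE.
Qed.

(** The loss of a single value is blamed on a single path of a single step: this is one branching of
    the derivation tree. *)
Lemma acons_reason lev t d u a :
  a \notin acons whole lev t d.+1 u ->
  exists tau w, [/\ tau < t, a \in acons whole lev tau d u,
    size w = lev tau, size u <= size w & take (size u) w = u] /\
    ~~ supported whole (fun=> acons whole lev tau d) w (size u) a.
Proof.
elim: t => [|t IH]; first by rewrite /= inE.
case: (boolP (a \in acons whole lev t d.+1 u)) => [aP|/IH[tau [w [[tt h1 h2 h3 h4] wP]]] _];
  last by exists tau, w; split=> //; split=> //; apply: ltnW.
rewrite inE aP negb_or -leqNgt /= => /andP[uw].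
case: (boolP [exists w : (lev t).-tuple A, (take (size u) w == u) &&
   ~~ supported whole (fun=> acons whole lev t d) w (size u) a]).
  case/existsP => w /andP[/eqP wu ws] _; exists t, w; split=> //; split=> //.
  - exact: (subsetP (acons_decd _ _ _ _ _)).
  - exact: size_tuple.
  - by rewrite size_tuple.
move/existsPn => H /all_extP[] x sx _.
have sux : size (u ++ x) == lev t by rewrite size_cat sx subnKC.
by have := H (Tuple sux); rewrite /= take_size_cat // eqxx /= negbK.
Qed.

Lemma eq_acons rho lev lev' t d u :
  (forall i, i < t -> lev i = lev' i) -> acons rho lev t d u = acons rho lev' t d u.
Proof.
elim: t d u => [|t IH] [|d] u // H.
have eqP e w : acons rho lev t e w = acons rho lev' t e w.
  by apply: IH => i it; apply: H; apply: ltnW.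
apply/setP => a; apply/aconsS/aconsS; rewrite H // eqP => -[aP K];
  split=> // w sw uw wu wr; apply: supported_mono (K w sw uw wu wr) => // j _;
  by rewrite eqP.
Qed.

End ArcConsistency.

(** * Relaxed constraints *)

Section Relaxation.

Variables (A : finType) (a0 : A) (n : nat) (R : {set (2 * n).+1.-tuple A}).
Variables (j : nat) (G : seq A -> {set A}) (x : A).
Hypothesis jn : j <= n.
Hypothesis Gst : forall i, i < j -> stable_at a0 R i G.

Implicit Types (u w y : seq A) (lev : nat -> nat).

Definition cut (B : finType) p (X : {set B}) i := if i < p then setT else X.

Lemma cut_anti p (X X' : {set A}) i : X \subset X' -> cut p X i \subset cut p X' i.
Proof. by rewrite /cut; case: ifP. Qed.

Lemma cut_whole p (X : {set A}) i : cut p X i \subset @whole A i.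
Proof. exact: subsetT. Qed.

Let rho := cut j [set x].

Definition good w := forall i, j <= i < size w -> nth a0 w i = x.

(* At depth j or more, a value is kept if a solution of S^(j-1) in G extends to it with
   all further labels equal to x. *)
Definition hull u : {set A} := [set a | if size u < j then a \in G u else
  [exists y : n.+1.-tuple A, [&& nth a0 y (size u) == a,
    [forall i : 'I_j, (nth a0 y i \in G (take i u)) &&
                      rSR R (@whole A) i (take i.+1 y) (take i u)] &
    holds R (y ++ take j u ++ nseq (n - j) x)]]].

Lemma good_take w i : good w -> good (take i w).
Proof.
move=> gw k; rewrite size_take_min leq_min => /andP[jk /andP[ki kw]].
by rewrite nth_take //; apply: gw; rewrite jk.
Qed.

Lemma good_ext w i : good w -> j <= i <= size w ->
  take i w = take j w ++ nseq (i - j) x.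
Proof.
move=> gw /andP[ji iw]; apply: (@eq_from_nth _ a0).
  by rewrite size_cat size_nseq !size_takel //; lia.
move=> p; rewrite size_takel // => pi.
rewrite nth_take // nth_cat size_takel; last by lia.
case: ltnP => jp; first by rewrite nth_take.
rewrite nth_nseq (_ : p - j < i - j) ?gw //; lia.
Qed.

Lemma hull_small u a : size u < j -> (a \in hull u) = (a \in G u).
Proof. by move=> uj; rewrite inE uj. Qed.

(** Once all labels from depth j on equal x, one tuple of R witnesses the relaxed constraints of
    every depth i >= j at once: its own entries y_(i+1), ..., y_n are the existential witnesses. *)
Lemma hull_path y w : size y = n.+1 -> good w -> j <= size w <= n ->
  (forall i, i < j -> nth a0 y i \in G (take i w)) ->
  (forall i, i < j -> rSR R (@whole A) i (take i.+1 y) (take i w)) ->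
  holds R (y ++ take j w ++ nseq (n - j) x) ->
  path_sat R rho w (take (size w).+1 y) /\
  (forall i, i <= size w -> nth a0 y i \in hull (take i w)).
Proof.
move=> sy gw /andP[jw wn] yG yS yR; split.
  apply/path_satP => i iw; rewrite take_takel //.
  have [ij|ji] := ltnP i j.
    by apply: rSR_anti (yS i ij) => i'; apply: cut_whole.
  have ei : take i w = take j w ++ nseq (i - j) x by apply: good_ext; rewrite ?ji.
  rewrite /rSR; case: ltnP => [lin|nin]; last first.
    have ein : i = n by lia.
    have -> : take i.+1 y = y by rewrite ein -sy take_size.
    by rewrite ei (_ : i - j = n - j) // ein.
  apply/forall_inP => x1; rewrite /rho /cut ltnNge ji inE => /eqP ->.
  apply/existsP; exists (nth a0 y i.+1).
  apply/forall_inP => x2; rewrite ltnNge (leqW ji) inE => /eqP ->.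
  have sd : size (drop i.+2 y) == n - i.+1 by rewrite size_drop sy; lia.
  apply/existsP; exists (Tuple sd) => /=.
  rewrite -cat_cons -drop_nth ?sy ?ltnS // catA cat_take_drop ei -catA.
  rewrite -[x :: _]/(nseq (n - i.+1).+1 x).
  by move: yR; rewrite (_ : n - j = (i - j) + (n - i.+1).+1) ?nseqD //; lia.
move=> i iw; have si : size (take i w) = i by rewrite size_takel.
have [ij|ji] := ltnP i j; first by rewrite hull_small ?si //; apply: yG.
have sy' : size y == n.+1 by apply/eqP.
rewrite inE si ltnNge ji /=; apply/existsP; exists (Tuple sy') => /=.
rewrite eqxx /= take_takel // yR andbT; apply/forallP => p.
by rewrite take_takel ?yG ?yS //; apply: leq_trans ji; apply: ltnW.
Qed.

(** In S^(j-1) the first universal variable is instantiated by the last label of [take j w], and the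
    repeated one by x. *)
Lemma hull_extend y w : 0 < j -> good w -> j <= size w <= n -> size y = j ->
  path_sat R (@whole A) (take j.-1 w) y ->
  (forall i, i < j -> nth a0 y i \in G (take i w)) ->
  exists y', [/\ size y' = (size w).+1, take j y' = y, path_sat R rho w y' &
    forall i, i <= size w -> nth a0 y' i \in hull (take i w)].
Proof.
move=> j0 gw jw sy /path_satP yw yG.
have sw : size (take j.-1 w) = j.-1 by rewrite size_takel //; lia.
have := yw j.-1; rewrite sw leqnn => /(_ isT).
rewrite /rSR (_ : j.-1 < n) ?prednK //.
have ty : take j y = y by rewrite -sy take_size.
rewrite ty take_takel // => /forall_inP/(_ (nth a0 w j.-1)).
rewrite inE => /(_ isT)/existsP[b]/forall_inP/(_ x); rewrite inE => /(_ isT).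
case/existsP => v yR; set Y := y ++ b :: v.
have sY : size Y = n.+1 by rewrite size_cat /= size_tuple sy; lia.
have tY i : i < j -> take i.+1 Y = take i.+1 y.
  by move=> ij; rewrite takel_cat // sy.
have nY i : i < j -> nth a0 Y i = nth a0 y i by move=> ij; rewrite nth_cat sy ij.
case: (@hull_path Y w) => //.
- by move=> i ij; rewrite nY //; apply: yG.
- move=> i ij; rewrite tY //; have := yw i; rewrite sw take_takel; first by apply; lia.
  by lia.
- have -> : take j w = rcons (take j.-1 w) (nth a0 w j.-1).
    by rewrite -take_nth ?prednK //; lia.
  by rewrite cat_rcons -catA.
move=> YS YH; exists (take (size w).+1 Y); split=> //.
- by rewrite size_takel // sY; lia.
- by rewrite take_takel ?leqW //; [rewrite -sy take_size_cat | lia].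
- by move=> i iw; rewrite nth_take //; apply: YH.
Qed.

Lemma hull_supported u w a : size w <= n -> good w -> size u <= size w ->
  take (size u) w = u -> a \in hull u ->
  supported a0 R rho (fun=> hull) w (size u) a.
Proof.
move=> wn gw uw wu aH; apply/supportedP.
(* Three cases: if u has depth at least j, the tuple defining the hull serves; if w has depth below
   j, stability of [G] does; otherwise a support along [take j.-1 w] is extended. *)
have [uj|ju] := ltnP (size u) j; last first.
  move: aH; rewrite inE ltnNge ju /= => /existsP[y /and3P[/eqP ya /forallP yG yR]].
  have tt i : i < j -> take i w = take i u.
    by move=> ij; rewrite -wu take_takel //; lia.
  case: (@hull_path y w) => //.
  - by rewrite size_tuple.
  - by lia.
  - by move=> i ij; rewrite tt //; have /andP[] := yG (Ordinal ij).
  - by move=> i ij; rewrite tt //; have /andP[] := yG (Ordinal ij).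
  - by move: yR; rewrite -wu take_takel.
  move=> yS yH; exists (take (size w).+1 y); split=> //.
  - by rewrite size_takel // size_tuple; lia.
  - by rewrite nth_take.
  - by move=> i iw; rewrite nth_take //; apply: yH.
rewrite hull_small // in aH; have [wj|jw] := ltnP (size w) j.
  have /supportedP[y [sy ya yw yG]] : supported a0 R (@whole A) (fun=> G) w (size u) a.
    by apply: (Gst wj) => //; rewrite wu.
  exists y; split=> //; first by apply: path_sat_anti yw => i; apply: cut_whole.
  move=> i iw; rewrite hull_small ?yG // size_takel //; lia.
have sw : size (take j.-1 w) = j.-1 by rewrite size_takel //; lia.
have /supportedP[y [sy ya yw yG]] :
    supported a0 R (@whole A) (fun=> G) (take j.-1 w) (size u) a.
  apply: (Gst (_ : j.-1 < j)); rewrite ?sw ?take_takel ?wu //; lia.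
case: (@hull_extend y w) => //; [lia|lia|by rewrite sy sw prednK //; lia| |].
  move=> i ij; have := yG i; rewrite sw take_takel; first by apply; lia.
  by lia.
move=> y' [sy' ty' y'w y'H]; exists y'; split=> //.
by rewrite -ya -ty' nth_take.
Qed.

(** The hull is closed under relaxed support, so no step ever removes any of it. The times and
    depths here are arbitrary, although [G] is only known to be stable at depths below j. *)
Lemma hull_acons lev t d u : (forall i, i < t -> lev i <= n) -> size u <= n ->
  good u -> hull u \subset acons a0 R rho lev t d u.
Proof.
elim: t d u => [|t IH] [|d] u levn un gu; try by rewrite ?acons0 subsetT.
have levt i : i < t -> lev i <= n by move=> it; apply: levn; apply: ltnW.
apply/subsetP => a aH; apply/aconsS; split; first exact: (subsetP (IH _ _ _ _ _)).
move=> w sw uw wu wr; have gw : good w.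
  move=> i /andP[ji iw]; have [iu|ui] := ltnP i (size u).
    by rewrite -(nth_take _ iu) wu; apply: gu; rewrite ji.
  by apply/eqP; have := wr i; rewrite ui iw /rho /cut ltnNge ji inE; apply.
have wn : size w <= n by rewrite sw levn.
apply: supported_mono (hull_supported wn gw uw wu aH) => // i iw.
apply: IH => //; last exact: good_take.
by rewrite size_take_min; lia.
Qed.

Lemma hull_supported_acons lev t d u w a : (forall i, i < t -> lev i <= n) ->
  size w <= n -> good w -> size u <= size w -> take (size u) w = u ->
  a \in hull u ->
  supported a0 R rho (fun=> acons a0 R rho lev t d) w (size u) a.
Proof.
move=> levn wn gw uw wu aH.
apply: supported_mono (hull_supported wn gw uw wu aH) => // i iw.
apply: hull_acons => //; last exact: good_take.
by rewrite size_take_min; lia.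
Qed.

End Relaxation.

(** * Chains of links *)

(** Locates the critical replacement in a hybrid argument. *)
Lemma switch (f : nat -> bool) m :
  f 0 -> ~~ f m -> exists2 i, i < m & f i && ~~ f i.+1.
Proof.
move=> f0; elim: m => [|m IH] fm; first by rewrite f0 in fm.
by case: (boolP (f m)) => [fm'|/IH[i im Hi]];
  [exists m; rewrite ?fm' | exists i; rewrite // ltnW].
Qed.

Section Chains.

Variables (k : nat) (n : nat) (R : {set (2 * n).+1.-tuple 'I_k}) (a0 : 'I_k).
Variable lev : nat -> nat.

Local Notation A := 'I_k.
Local Notation dom := (dom a0 R lev).
Local Notation acons := (fun rho => acons a0 R rho lev).
Local Notation supported := (supported a0 R).
Local Notation whole := (@whole A).

Implicit Types (z : k.-tuple A) (u w : seq A) (rho : nat -> {set A}).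

Definition value z u : seq A := map (tnth z) u.

Lemma size_value z u : size (value z u) = size u.
Proof. exact: size_map. Qed.

Lemma value_take z i u : value z (take i u) = take i (value z u).
Proof. exact: map_take. Qed.

Lemma value_id u : value (ord_tuple k) u = u.
Proof. by rewrite /value -[RHS]map_id; apply: eq_map => a; rewrite tnth_ord_tuple. Qed.

Definition relabel z z1 : k.-tuple A := map_tuple (tnth z) z1.

Lemma value_relabel z z1 u : value (relabel z z1) u = value z (value z1 u).
Proof. by rewrite /value -map_comp; apply: eq_map => a /=; rewrite tnth_map. Qed.

(* A link derives a restriction of the variable e_tgt from the restriction of the
   variable at position e_pos of e_path, by the constraint of e_path at step
   e_time.  It is the critical replacement of a hybrid argument: the constraints
   e_done of the same step and the variables at smaller positions are already
   restricted by their final domains, the others only by derivations of depth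
   e_depth. *)
Record edge := Edge {
  e_tgt : seq A; e_bound : nat; e_depth : nat; e_time : nat;
  e_done : seq (seq A); e_path : seq A; e_pos : nat }.

Definition e_src e := take (e_pos e) (e_path e).

Definition side rho e a i u : {set A} :=
  if i < e_pos e then acons rho (e_time e) (e_time e) u
  else if i == e_pos e then [set a]
  else acons rho (e_time e) (e_depth e) u.

(** The first three conditions collect what the hybrid argument has secured for b before reaching
    this position. With them, failure of the next hybrid says exactly that no final value of the
    source is linked to an admissible b. *)
Definition link rho e z (a b : A) : bool :=
  [&& b \in acons rho (e_time e) (e_time e) (value z (e_tgt e)),
      b \in acons rho (e_bound e) (e_depth e).+1 (value z (e_tgt e)),
      all (fun w => supported rho (fun=> acons rho (e_time e) (e_time e))
                      (value z w) (size (e_tgt e)) b) (e_done e) &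
      supported rho (side rho e a) (value z (e_path e)) (size (e_tgt e)) b].

(** The newest link comes first, so the head has the source on which the next link will be built.
    These are the values from which the whole chain can be walked; they become the backward sets
    C. *)
Fixpoint reach (es : seq edge) z : {set A} :=
  if es is e :: es' then
    [set a | [exists b in reach es' z, link whole e z a b]]
  else setT.

Definition erelabel z1 e := Edge (value z1 (e_tgt e)) (e_bound e) (e_depth e)
  (e_time e) (map (value z1) (e_done e)) (value z1 (e_path e)) (e_pos e).

Lemma link_relabel rho z1 e z a b :
  link rho (erelabel z1 e) z a b = link rho e (relabel z z1) a b.
Proof.
rewrite /link /= !value_relabel size_value all_map.
by do 3!congr (_ && _); apply: eq_all => w; rewrite /= value_relabel.
Qed.

Lemma reach_relabel z1 es z :
  reach (map (erelabel z1) es) z = reach es (relabel z z1).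
Proof.
elim: es => //= e es IH; apply/setP => a; rewrite !inE IH.
by apply: eq_existsb => b; rewrite link_relabel.
Qed.

Variable t0 : nat.
Implicit Types (top : seq A) (es : seq edge) (e : edge).

Definition es_src top es := if es is e :: _ then e_src e else top.
Definition es_time es := if es is e :: _ then e_time e else t0.

Definition edge_ok e t u :=
  [&& e_tgt e == u, e_bound e == t, e_time e < t,
      size (e_path e) == lev (e_time e),
      size u <= size (e_path e),
      take (size u) (e_path e) == u,
      e_pos e <= size (e_path e) &
      all (fun w => [&& size w == lev (e_time e), size u <= size w &
                        take (size u) w == u]) (e_done e)].


(** Distinct source and target positions serve definability, the nonempty intersections keep the
    backward sets nonempty, and the strict growth of the path serves the crossing. The topmost link
    is exempt from the latter because nothing is known yet about the values at its target. *)
Fixpoint chain_ok top es {struct es} : Prop :=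
  if es is e :: es' then
    [/\ edge_ok e (es_time es') (es_src top es'), e_pos e != size (e_tgt e),
        forall z, reach es' z :&: dom (e_time e) (value z (e_tgt e)) != set0,
        es' <> [::] -> size (e_tgt e) < size (e_path e) & chain_ok top es']
  else True.

(** The gap on which the hybrid argument feeds: depth d never empties the restricted source, but the
    final domain does at some parameter. Each new link costs one unit of d. *)
Definition pending top es d : Prop :=
  (forall z, reach es z :&: acons whole (es_time es) d (value z (es_src top es))
             != set0) /\
  (exists z, reach es z :&: dom (es_time es) (value z (es_src top es)) = set0).

Lemma edge_okP e t u : reflect
  [/\ [/\ e_tgt e = u, e_bound e = t & e_time e < t],
      [/\ size (e_path e) = lev (e_time e), size u <= size (e_path e) &
          take (size u) (e_path e) = u], e_pos e <= size (e_path e) &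
      forall w, w \in e_done e ->
        [/\ size w = lev (e_time e), size u <= size w & take (size u) w = u]]
  (edge_ok e t u).
Proof.
rewrite /edge_ok; apply: (iffP idP).
  case/and5P => /eqP ? /eqP ? ? /eqP ? /and4P[? /eqP ? ? /allP H]; split=> // w /H.
  by case/and3P => /eqP ? ? /eqP ?.
case=> -[-> -> ->] [-> -> ->] -> H; rewrite !eqxx /=; apply/allP => w /H.
by case=> -> -> ->; rewrite !eqxx.
Qed.

Lemma size_e_src e t u : edge_ok e t u -> size (e_src e) = e_pos e.
Proof. by case/edge_okP => _ _ ep _; rewrite size_takel. Qed.

Lemma edge_ok_relabel z1 e t u :
  edge_ok e t u -> edge_ok (erelabel z1 e) t (value z1 u).
Proof.
case/edge_okP => -[h1 h2 h3] [h4 h5 h6] h7 h8; apply/edge_okP; split.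
- by rewrite /= h1.
- by rewrite /= !size_value -value_take h6.
- by rewrite /= size_value.
by move=> _ /mapP[w /h8[s1 s2 s3] ->]; rewrite !size_value -value_take; split=> //; rewrite s3.
Qed.

Lemma erelabel_src z1 e : e_src (erelabel z1 e) = value z1 (e_src e).
Proof. by rewrite /e_src /= value_take. Qed.


Lemma es_time_relabel z1 es : es_time (map (erelabel z1) es) = es_time es.
Proof. by case: es. Qed.

Lemma es_src_relabel z1 top es :
  es_src (value z1 top) (map (erelabel z1) es) = value z1 (es_src top es).
Proof. by case: es => // e es; exact: erelabel_src. Qed.

Lemma chain_ok_relabel z1 top es :
  chain_ok top es -> chain_ok (value z1 top) (map (erelabel z1) es).
Proof.
elim: es => //= e es IH [eok ep eD esz /IH esok]; split=> //.
- by rewrite es_time_relabel es_src_relabel; apply: edge_ok_relabel.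
- by rewrite size_value.
- by move=> z; rewrite reach_relabel -value_relabel.
by rewrite !size_value => ne; apply: esz; case: (es) ne.
Qed.

(* Values surviving above a link extend to a tuple satisfying the path
   constraints, because the sides are cut down in order of depth. *)
Lemma reach_support top e es z a :
  chain_ok top (e :: es) -> a \in reach (e :: es) z ->
  exists y, [/\ size y = (size (e_src e)).+1, nth a0 y (size (e_src e)) = a,
    path_sat R whole (value z (e_src e)) y &
    forall i, i < size (e_src e) ->
      nth a0 y i \in dom (e_time e) (take i (value z (e_src e)))].
Proof.
move=> [eok _ _ _ _]; rewrite inE => /existsP[b /andP[_ /and4P[_ _ _]]].
have sv := size_e_src eok.
case/edge_okP: eok => _ [sw _ _] pw _.
case/supportedP => y [sy yb yw yS]; rewrite size_value in sy yS.
exists (take (e_pos e).+1 y); rewrite sv value_take; split.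
- by rewrite size_takel // sy ltnS.
- rewrite nth_take //; have := yS _ pw.
  by rewrite /side ltnn eqxx inE => /eqP.
- by apply: path_sat_take; rewrite ?size_value.
move=> i ip; rewrite nth_take; last by apply: leqW.
rewrite take_takel; last exact: ltnW.
by have := yS i (leq_trans (ltnW ip) pw); rewrite /side ip.
Qed.

(* Relabelling moves the parameter where a domain dies to the identity, where the
   labels occurring in the instance exhaust the values quantified over in dom. *)
Lemma chain_step top es d : chain_ok top es -> pending top es d.+1 ->
  exists z1 e, let es1 := e :: map (erelabel z1) es in
    chain_ok (value z1 top) es1 /\ pending (value z1 top) es1 d.
Proof.
move=> esok [live [zd dead]].
pose u := es_src top es; pose t := es_time es.
(* First hybrid, over time. The domain of depth [d.+1] is kept throughout, and [dom 0] is
   everything. *)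
pose f m := [forall z, reach es z :&: dom m (value z u)
               :&: acons whole t d.+1 (value z u) != set0].
have f0 : f 0 by apply/forallP => z; rewrite /dom /= setIT; apply: live.
have ft : ~~ f t.
  by apply/forallPn; exists zd; rewrite negbK dead set0I.
have [tau tt /andP[/forallP ftau /forallPn[z1 /negPn/eqP fz1]]] := switch f0 ft.
pose es1 := map (erelabel z1) es; pose u1 := value z1 u.
have su1 : size u1 = size u by apply: size_value.
pose C1 z := reach es1 z :&: dom tau (value z u1)
               :&: acons whole t d.+1 (value z u1).
have C1E z : C1 z = reach es (relabel z z1) :&: dom tau (value (relabel z z1) u)
               :&: acons whole t d.+1 (value (relabel z z1) u).
  by rewrite /C1 reach_relabel value_relabel.
have C1n z : C1 z != set0 by rewrite C1E.
have C1id a : a \in C1 (ord_tuple k) -> a \notin dom tau.+1 u1.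
  rewrite C1E; have -> : relabel (ord_tuple k) z1 = z1.
    by apply/val_inj; rewrite /= -[RHS]map_id; apply: eq_map => b; rewrite tnth_ord_tuple.
  rewrite !inE => /andP[/andP[h1 _] h2]; apply/negP => h3.
  by have := in_set0 a; rewrite -fz1 !inE h1 h2 /u1 h3.
have C1dom z a : a \in C1 z -> a \in dom tau (value z u1).
  by rewrite !inE => /andP[/andP[]].
have [ulev|] := leqP (size u) (lev tau); last first.
  move=> ulev; case/set0Pn: (C1n (ord_tuple k)) => a aC.
  case/negP: (C1id a aC); apply/domS; split; last by rewrite su1; lia.
  by have := C1dom _ _ aC; rewrite value_id.
pose L := [seq u1 ++ tval x | x <- enum {: (lev tau - size u).-tuple A}].
have LP w : reflect (size w = lev tau /\ take (size u) w = u1) (w \in L).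
  apply: (iffP mapP) => [[x _ ->]|[sw wu]].
    by rewrite size_cat size_tuple su1 subnKC // take_size_cat.
  have sd : size (drop (size u) w) == lev tau - size u by rewrite size_drop sw.
  by exists (Tuple sd); rewrite ?mem_enum //= -wu cat_take_drop.
(* Second hybrid, over the paths treated at step [tau]. At the identity parameter [L] lists all
   paths of that depth through [u1], so a value supported along all of them would survive in
   [dom tau.+1]. *)
pose g m := [forall z, exists b in C1 z, all (fun w => supported whole
    (fun=> dom tau) (value z w) (size u) b) (take m L)].
have g0 : g 0.
  by apply/forallP => z; have /set0Pn[b bC] := C1n z; apply/exists_inP; exists b;
     rewrite ?take0.
have gL : ~~ g (size L).
  apply/forallPn; exists (ord_tuple k); apply/exists_inPn => b bC.
  rewrite take_size; apply/negP => /allP bL; case/negP: (C1id b bC).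
  apply/domS; split; first by have := C1dom _ _ bC; rewrite value_id.
  move=> w sw _ wu; rewrite su1 in wu *.
  by have := bL w; rewrite value_id; apply; apply/LP.
have [r rL /andP[/forallP gr /forallPn[z2 /exists_inPn gz2]]] := switch g0 gL.
pose ws := take r L; pose w := nth [::] L r.
have /LP[sw wu] : w \in L by apply: mem_nth.
(* Third hybrid, over the positions of [w]: final domains before position m, depth d from m on. For
   m = 0, membership of b at depth [d.+1] provides the support. *)
pose S m i := if i < m then acons whole tau tau else acons whole tau d.
pose C2 z b := (b \in C1 z) && all (fun w => supported whole
    (fun=> dom tau) (value z w) (size u) b) ws.
pose h m := [forall z, exists b, C2 z b &&
   supported whole (S m) (value z w) (size u) b].
have h0 : h 0.
  apply/forallP => z; have /exists_inP[b bC bws] := gr z.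
  apply/existsP; exists b; rewrite /C2 bC bws /=.
  have := bC; rewrite !inE => /andP[_ bP].
  have := acons_supported bP tt (_ : size (value z w) = lev tau).
  rewrite !size_value sw; apply=> //.
  by rewrite -value_take wu.
have hn : ~~ h (size w).+1.
  apply/forallPn; exists z2; apply/existsPn => b; apply/negP => /andP[/andP[bC bws] bw].
  case/negP: (gz2 b bC); rewrite (take_nth [::]) // all_rcons bws andbT.
  apply: supported_mono bw => // i; rewrite size_value => iw.
  by rewrite /S ltnS iw.
have [p pw /andP[/forallP hp /forallPn[z3 /existsPn hz3]]] := switch h0 hn.
pose e := Edge u1 t d tau ws w p.
have u1w : size u1 <= size w by rewrite su1 sw.
have eok : edge_ok e (es_time es1) (es_src (value z1 top) es1).
  rewrite es_time_relabel es_src_relabel; apply/edge_okP; split=> //=.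
    by split=> //; rewrite size_value.
  by move=> w' /mem_take/LP[sw' wu']; rewrite sw' size_value.
have es1ok : chain_ok (value z1 top) es1 by apply: chain_ok_relabel.
have linkE z a b : b \in reach es1 z -> link whole e z a b ->
    C2 z b /\ supported whole (side whole e a) (value z w) (size u) b.
  move=> br /and4P[h1 h2 h3 h4]; rewrite su1 in h3 h4; split=> //.
  by rewrite /C2 !inE br h1 h2.
(* At position [size u1] the tuple has the entry b, which is in the final domain already, so that
   replacement cannot be critical. *)
have pu : p != size u1.
  rewrite su1; apply/negP => /eqP pu; have /existsP[b /andP[bC]] := hp z3.
  case/supportedP => y [sy yb yw yS]; case/negP: (hz3 b); rewrite bC /=.
  apply/supportedP; exists y; split=> // i iw; have := yS i iw.
  rewrite /S ltnS; case: ltngtP => // -> _; rewrite pu yb -value_take wu.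
  by have /andP[/C1dom] := bC.
exists z1, e; split.
  split=> //; first by move=> z; case/set0Pn: (C1n z) => b; rewrite !inE;
    case/andP=> /andP[b1 b2] _; apply/set0Pn; exists b; rewrite inE b1.
  (* If [w] were no longer than [u1], it would equal [u1]. The previous link already supports a
     along [u1] by domains of a later time, so a would survive step [tau]. *)
  move=> esn /=; rewrite ltn_neqAle u1w andbT; apply/negP => /eqP uw.
  have : es1 <> [::] by [].
  case E1 : es1 => [//|e1 es2] _; case/set0Pn: (C1n (ord_tuple k)) => a aC.
  case/negP: (C1id a aC); have adom := C1dom _ _ aC.
  rewrite value_id in adom; apply/domS; split=> // w' sw' _ wu'.
  have ew : w' = u1 by rewrite -wu' take_oversize // sw' -sw uw.
  move: aC es1ok; rewrite 2!inE E1 => /andP[/andP[ar _] _] es1ok.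
  have [y [sy ya yw yS]] := reach_support es1ok ar.
  have es1src : e_src e1 = u1 by have := es_src_relabel z1 top es; rewrite -/es1 E1.
  have tau1 : tau < e_time e1 by have := es_time_relabel z1 es; rewrite -/es1 E1 /= => ->.
  rewrite es1src value_id in sy ya yw yS.
  rewrite ew; apply/supportedP; exists y; split=> // i.
  rewrite leq_eqVlt => /predU1P[->|iu]; first by rewrite take_size ya.
  exact: (subsetP (dom_le _ _ _ _ (ltnW tau1))) (yS i iu).
split.
  move=> z; have /existsP[b /andP[bC /supportedP[y [sy yb yw yS]]]] := hp z.
  rewrite size_value in sy yS.
  apply/set0Pn; exists (nth a0 y p); rewrite inE; apply/andP; split; last first.
    have := yS p pw; rewrite /S ltnn /= /e_src /= value_take; exact.
  have /andP[] := bC; rewrite 2!inE => /andP[/andP[b1 b2] b3] b4.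
  rewrite inE; apply/existsP; exists b; rewrite b1 /= /link /= b2 b3 su1 b4 /=.
  apply/supportedP; exists y; split=> //; rewrite size_value // => i iw.
  rewrite /side /=; have := yS i iw; rewrite /S; case: ltngtP => // -> _.
  by rewrite inE.
exists z3; apply/setP => a; rewrite in_set0 /=; apply/negbTE; rewrite inE; apply/negP.
case/andP; rewrite inE => /existsP[b /andP[br /(linkE _ _ _ br)[bC]]].
case/supportedP => y [sy yb yw yS] aD.
case/negP: (hz3 b); rewrite bC /=; apply/supportedP; exists y; split=> // i iw.
have := yS i iw; rewrite /side /S /= ltnS; case: ltngtP => //= ->.
by rewrite inE => /eqP ->; move: aD; rewrite /e_src /= value_take.
Qed.

End Chains.

(** * Scheduling the constraints *)

Section Schedule.

Variables (A : finType) (a0 : A) (n : nat) (R : {set (2 * n).+1.-tuple A}).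

Implicit Types (lev : nat -> nat) (G : seq A -> {set A}).

Lemma stable_atP j G : reflect (stable_at a0 R j G)
  [forall w : j.-tuple A, [forall i : 'I_j.+1, [forall a in G (take i w),
    supported a0 R (@whole A) (fun=> G) w i a]]].
Proof.
apply: (iffP forallP) => [H w i a sw ij aG|H w].
  have sw' : size w == j by apply/eqP.
  have /forallP/(_ (Ordinal (ij : i < j.+1)))/forall_inP := H (Tuple sw').
  exact.
apply/forallP => i; apply/forall_inP => a; apply: H; first exact: size_tuple.
exact: leq_ord.
Qed.

(** Stability is what the hull at depth [lev t] requires of the domains just before step t.
    Nonemptiness is asked only before time T and keeps the forward sets nonempty. *)
Definition schedule lev T : Prop :=
  [/\ forall t, t < T -> lev t <= n,
      forall t i, t < T -> i < lev t -> stable_at a0 R i (dom a0 R lev t) &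
      forall t u, t < T -> size u <= n -> dom a0 R lev t u != set0].

Lemma schedule_exists : exists lev T, schedule lev T /\
  ((forall i, i <= n -> stable_at a0 R i (dom a0 R lev T)) /\
   (forall u, size u <= n -> dom a0 R lev T u != set0) \/
   exists2 u, size u <= n & dom a0 R lev T u = set0).
Proof.
match goal with |- ?g => pose goal := g; change goal end.
pose mass lev t := \sum_(s : n.-bseq A) #|dom a0 R lev t s|.
(* N counts steps, each of which removes at least one value, so it cannot exceed the initial
   mass. *)
suff step N : goal \/ exists lev T, schedule lev T /\
    mass lev T + N <= mass (fun=> 0) 0.
  by case: (step (mass (fun=> 0) 0).+1) => // -[lev [T [_]]]; lia.
elim: N => [|N [|[lev [T [levT massT]]]]]; [|by left|].
  by right; exists (fun=> 0), 0; rewrite addn0; split=> //; split.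
case: (boolP [exists s : n.-bseq A, dom a0 R lev T s == set0]) => [|/existsPn ne].
  case/existsP => s /eqP s0; left; exists lev, T; split=> //; right.
  by exists s; rewrite // size_bseq.
have neT u : size u <= n -> dom a0 R lev T u != set0.
  by move=> un; apply: (ne (Bseq un)).
pose bad j := (j <= n) && ~~ [forall w : j.-tuple A, [forall i : 'I_j.+1,
  [forall a in dom a0 R lev T (take i w),
    supported a0 R (@whole A) (fun=> dom a0 R lev T) w i a]]].
case: (boolP [exists j : 'I_n.+1, bad j]) => [ex|/existsPn st]; last first.
  left; exists lev, T; split=> //; left; split=> // i iin.
  apply/stable_atP; apply: contraR (st (Ordinal (iin : i < n.+1))) => bi.
  by rewrite /bad iin bi.
have {}ex : exists j, bad j by case/existsP: ex => j; exists j.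
case: (ex_minnP ex) => j /andP[jn jbad] jmin; right.
pose lev' t := if t == T then j else lev t.
have levE t u : t <= T -> dom a0 R lev' t u = dom a0 R lev t u.
  by move=> tT; apply: eq_acons => i it; rewrite /lev' (_ : i == T = false) //; lia.
have levE' t : t < T -> lev' t = lev t by move=> tT; rewrite /lev' ltn_eqF.
have levT' : lev' T = j by rewrite /lev' eqxx.
have stabE t i : t <= T ->
    stable_at a0 R i (dom a0 R lev t) -> stable_at a0 R i (dom a0 R lev' t).
  move=> tT st w p a sw pi; rewrite levE // => /(st w p a sw pi).
  by apply: supported_mono => // q _; rewrite levE.
exists lev', T.+1; case: levT => levn levst levne; split.
  split=> t; rewrite ltnS leq_eqVlt.
  - by case/predU1P => [->|tT]; rewrite ?levT' ?levE' //; apply: levn.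
  - move=> i /predU1P[->|tT]; [rewrite levT' => ij|rewrite levE' // => ij];
      apply: stabE; rewrite // 1?ltnW //; last exact: levst.
    apply/stable_atP; apply: contraTT (ij) => bi; rewrite -leqNgt; apply: jmin.
    by rewrite /bad bi andbT; lia.
  - move=> u /predU1P[->|tT] un; rewrite levE // ?neT ?levne //; exact: ltnW.
have sub s : dom a0 R lev' T.+1 s \subset dom a0 R lev T s.
  by rewrite -levE //; apply: dom_le.
suff lt : mass lev' T.+1 < mass lev T by lia.
case/forallPn: jbad => w /forallPn[i /forall_inPn[a aD anS]].
have si : size (take i w) = i by rewrite size_takel // size_tuple -ltnS.
have sin : size (take i w) <= n by rewrite si; have := ltn_ord i; lia.
pose s := Bseq sin; rewrite /mass (bigD1 s) //= [ltnRHS](bigD1 s) //=.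
rewrite -addSn; apply: leq_add; last by apply: leq_sum => s' _; apply: subset_leq_card.
apply: proper_card; apply/properP; split; first exact: sub.
exists a => //; apply/negP => /domS[_ /(_ w)]; rewrite si size_tuple levT'.
move=> H; case/negP: anS; have := H erefl _ erefl.
rewrite -ltnS ltn_ord => /(_ isT); apply: supported_mono => // q _.
by rewrite levE.
Qed.

End Schedule.

(** * Small derivations *)

Lemma card_bigcup_le (I T : finType) (P : pred I) (F : I -> {set T}) m :
  (forall i, P i -> #|F i| <= m) -> #|\bigcup_(i | P i) F i| <= #|P| * m.
Proof.
move=> Fm; rewrite -sum_nat_const; elim/big_ind2: _ => [|s X r Y h1 h2|i Pi].
- by rewrite cards0.
- by rewrite (leq_trans (leq_card_setU _ _).1) ?leq_add.
exact: Fm.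
Qed.

Section Counting.

Variables (n k : nat) (R : {set (2 * n).+1.-tuple 'I_k}) (a0 : 'I_k).
Local Notation A := 'I_k.
Local Notation whole := (@whole A).
Local Notation word := (n.-bseq A).
Implicit Types (u w : seq A) (f : word -> A).

Definition bword u : word := insub_bseq n u.

Lemma bwordK u : size u <= n -> bword u = u :> seq A.
Proof. by move=> un; rewrite /bword /insub_bseq /insubd insubT. Qed.

Lemma SR_rSR m (ys : m.+1.-tuple A) (xs : m.-tuple A) :
  SR R ys xs = rSR R whole m ys xs.
Proof.
rewrite /SR /rSR; case: ifP => // _.
apply: eq_forallb => x; rewrite [x \in _]in_setT; apply: eq_existsb => y.
by apply: eq_forallb => x'; rewrite [x' \in _]in_setT.
Qed.

Lemma scope_nth (s : word) (j : 'I_(size s).+1) z :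
  tnth (cscope (IR R s)) j = bword (take j s) /\
  (forall ys : (size s).+1.-tuple A,
    (ys \in crel (IR R s) z) = rSR R whole (size s) ys (value z s)).
Proof.
split; last by move=> ys; rewrite inE SR_rSR.
rewrite tnth_mktuple; apply: val_inj; rewrite /= bwordK //.
by rewrite size_take_min (leq_trans (geq_minr _ _)) ?size_bseq.
Qed.

Lemma solution_constraint (J : {set word}) z f w :
  is_solution (IR R) J z f -> size w <= n -> bword w \in J ->
  rSR R whole (size w) (mkseq (fun j => f (bword (take j w))) (size w).+1)
    (value z w).
Proof.
move=> sol wn /sol; have ord := @Ordinal (size (bword w)).+1 0 isT.
rewrite (scope_nth ord z).2.
have -> : map_tuple f (cscope (IR R (bword w))) =
    mkseq (fun j => f (bword (take j w))) (size w).+1 :> seq A.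
  apply: (@eq_from_nth _ a0); first by rewrite size_tuple size_mkseq /= bwordK.
  move=> i; rewrite size_tuple => iw.
  rewrite -(tnth_nth a0 (map_tuple f _) (Ordinal iw)) tnth_map.
  rewrite (scope_nth _ z).1 nth_mkseq /= ?bwordK //.
  by rewrite /= bwordK in iw.
by rewrite bwordK.
Qed.

Lemma scope_vars w (v : word) : size w <= n -> v \in cscope (IR R (bword w)) ->
  exists2 j, j <= size w & v = bword (take j w).
Proof.
move=> wn /tnthP[j ->]; have ew : bword w = w :> seq A by rewrite bwordK.
exists j; first by rewrite -ltnS (leq_trans (ltn_ord j)) //= ew.
by rewrite (scope_nth j (ord_tuple k)).1; congr (bword (take _ _)).
Qed.

(** Each of the k values at a variable is refuted along one path, with at most n further variables,
    each needing a derivation of smaller depth. *)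
Fixpoint var_bound d := if d is d'.+1 then (n * k * var_bound d').+1 else 1.

(** The variable of u is counted even when no constraint of [J] contains it. It is shared by the
    refutations of all values, so it enters the recursion only once. *)
Lemma small_derivation lev t d u : (forall i, i < t -> lev i <= n) ->
  size u <= n ->
  exists J : {set word}, #|bword u |: inst_vars (IR R) J| <= var_bound d /\
    forall f, is_solution (IR R) J (ord_tuple k) f ->
      f (bword u) \in acons a0 R whole lev t d u.
Proof.
elim: d t u => [|d IH] t u levn un.
  exists set0; rewrite /inst_vars big_set0 setU0 cards1; split=> // f _.
  by rewrite acons0 inE.
have reason a : exists J : {set word},
    #|inst_vars (IR R) J :\ bword u| <= n * var_bound d /\
    (a \notin acons a0 R whole lev t d.+1 u ->
     forall f, is_solution (IR R) J (ord_tuple k) f -> f (bword u) != a).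
  case: (boolP (a \in acons a0 R whole lev t d.+1 u)) => [aP|].
    by exists set0; rewrite /inst_vars big_set0 set0D cards0; split.
  case/acons_reason => tau [w [[tt aP sw uw wu] ns]].
  have wn : size w <= n by rewrite sw levn.
  have tn i : size (take i w) <= n by rewrite size_take_min; lia.
  have levn' i : i < tau -> lev i <= n by move=> it; apply: levn; apply: ltn_trans tt.
  have /fin_all_exists[Jf JfP] (i : 'I_(size w).+1) := IH tau (take i w) levn' (tn i).
  (* The constraints of all prefixes are included, as [path_sat] demands. They involve only the
     variables on the path. *)
  pose Jt := [set bword (take i w) | i : 'I_(size w).+1].
  exists (Jt :|: \bigcup_(i : 'I_(size w).+1 | i != size u :> nat) Jf i); split=> [|_ f sol].
    apply: (@leq_trans #|\bigcup_(i : 'I_(size w).+1 | i != size u :> nat)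
                          (bword (take i w) |: inst_vars (IR R) (Jf i))|).
      apply/subset_leq_card/subsetP => v; rewrite !inE => /andP[vu /bigcupP[c]].
      rewrite !inE => /orP[/imsetP[i _ ->]|/bigcupP[i iu ci]] vc; last first.
        by apply/bigcupP; exists i; rewrite // inE; apply/orP; right;
           apply/bigcupP; exists c; rewrite // inE.
      have [j ji ev] := scope_vars (tn i) vc.
      have jw : j < (size w).+1.
        by rewrite ltnS (leq_trans ji) // size_take_min geq_minr.
      have et : take j (take i w) = take j w.
        by rewrite take_takel // (leq_trans ji) // size_take_min geq_minl.
      apply/bigcupP; exists (Ordinal jw) => /=; last by rewrite ev et in_setU1 eqxx.
      by apply: contraNneq vu => ju; rewrite ev et ju wu.
    apply: leq_trans (@card_bigcup_le _ _ _ _ (var_bound d) _) _; first by move=> i _; case: (JfP i).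
    rewrite leq_mul2r; apply/orP; right; apply: leq_trans wn.
    have uw' : size u < (size w).+1 by [].
    rewrite (@eq_card _ _ (predC1 (Ordinal uw'))) ?cardC1 ?card_ord //.
  apply: contra ns => /eqP fu; apply/supportedP.
  have solJ (J : {set word}) : J \subset Jt :|: \bigcup_(i : 'I_(size w).+1 | i != size u :> nat) Jf i ->
      is_solution (IR R) J (ord_tuple k) f by move=> sJ c /(subsetP sJ)/sol.
  exists (mkseq (fun j => f (bword (take j w))) (size w).+1); split.
  - by rewrite size_mkseq.
  - by rewrite nth_mkseq // wu.
  - apply/path_satP => i iw.
    have := solution_constraint sol (tn i); rewrite size_takel // value_id.
    have -> : bword (take i w) \in Jt :|: \bigcup_(i : 'I_(size w).+1 | i != size u :> nat) Jf i.
      by rewrite inE; apply/orP; left; apply/imsetP; exists (Ordinal (iw : i < (size w).+1)).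
    move=> /(_ isT); congr rSR; apply: (@eq_from_nth _ a0).
      by rewrite size_mkseq size_takel // size_mkseq.
    move=> j; rewrite size_mkseq => ji; rewrite nth_take // !nth_mkseq //; last first.
      exact: leq_trans ji _.
    by rewrite take_takel.
  move=> j jw; rewrite nth_mkseq //; have [->|ju] := eqVneq j (size u).
    by rewrite wu fu.
  have [_] := JfP (Ordinal (jw : j < (size w).+1)); apply; apply: solJ.
  by apply: subset_trans (subsetUr _ _); apply: (bigcup_sup (Ordinal _)).
have {reason}/fin_all_exists[Jf JfP] := reason.
exists (\bigcup_a Jf a); split=> [|f sol].
  rewrite /= -add1n.
  have -> : bword u |: inst_vars (IR R) (\bigcup_a Jf a) =
      bword u |: \bigcup_a (inst_vars (IR R) (Jf a) :\ bword u).
    apply/setP => v; rewrite !inE; case: eqVneq => //= vu.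
    apply/bigcupP/bigcupP => [[c /bigcupP[a _ ca] vc]|[a _]].
      by exists a; rewrite // !inE vu; apply/bigcupP; exists c.
    by rewrite !inE vu => /bigcupP[c ca vc]; exists c => //; apply/bigcupP; exists a.
  apply: leq_trans (leq_card_setU _ _).1 _; rewrite cards1 leq_add2l.
  apply: leq_trans (@card_bigcup_le _ _ _ _ (n * var_bound d) _) _; first by move=> a _; case: (JfP a).
  by rewrite card_ord mulnCA mulnA.
apply/negPn/negP => fP; have [_ /(_ fP f)] := JfP (f (bword u)).
rewrite eqxx; suff sJ : is_solution (IR R) (Jf (f (bword u))) (ord_tuple k) f by case/(_ sJ).
by move=> c cJ; apply: sol; apply/bigcupP; exists (f (bword u)).
Qed.

End Counting.

(** * Closure properties of q-definability *)

Section TupleRcons.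

Variables (T : Type).

Lemma tnth_rcons_lift m (t : m.-tuple T) a (i : 'I_m) :
  tnth [tuple of rcons t a] (lift ord_max i) = tnth t i.
Proof.
by rewrite !(tnth_nth a) /= /bump leqNgt ltn_ord add0n nth_rcons size_tuple ltn_ord.
Qed.

Lemma tnth_rcons_max m (t : m.-tuple T) a :
  tnth [tuple of rcons t a] ord_max = a.
Proof. by rewrite (tnth_nth a) /= nth_rcons size_tuple ltnn eqxx. Qed.

Lemma eq_rcons_tuple m (t : m.-tuple T) a (t' : m.+1.-tuple T) :
  (forall i, tnth t' (lift ord_max i) = tnth t i) -> tnth t' ord_max = a ->
  t' = [tuple of rcons t a].
Proof.
move=> h1 h2; apply: eq_from_tnth => i.
by case: (unliftP ord_max i) => [j|] ->; rewrite ?tnth_rcons_lift ?tnth_rcons_max.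
Qed.

End TupleRcons.

Section Definability.

Variables (A : finType) (a0 : A) (s : nat) (R : {set s.-tuple A}).

Definition qf_definable m (F : m.-tuple A -> bool) : Prop :=
  exists phi : qformula s m, forall t, qsat R phi t = F t.

Lemma qf_rename m (phi : qformula s m) m' (f : 'I_m -> 'I_m') :
  qf_definable (fun t : m'.-tuple A => qsat R phi [tuple tnth t (f i) | i < m]).
Proof.
elim: phi m' f => {m} m => [atoms|phi IH|phi IH] m' f.
- exists (QConj [seq map_tuple f v | v : s.-tuple 'I_m <- atoms]) => t /=.
  rewrite all_map; apply: eq_all => v /=; congr (_ \in R).
  by apply: eq_from_tnth => i; rewrite !tnth_map tnth_ord_tuple.
all: pose f' i := if unlift ord_max i is Some j then lift ord_max (f j) else ord_max.
all: have [psi psiP] := IH m'.+1 f'.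
1: exists (QForall psi) => t /=; apply: eq_forallb => a.
2: exists (QExists psi) => t /=; apply: eq_existsb => a.
all: rewrite psiP; congr qsat; apply: eq_rcons_tuple => [i|].
all: by rewrite !tnth_mktuple /f' ?liftK ?unlift_none ?tnth_rcons_lift ?tnth_rcons_max.
Qed.

(** The quantifiers of one formula are pulled over the other, whose variables are shifted. For a
    universal quantifier this needs [a0]: over an empty domain it would hold vacuously. *)
Lemma qf_and m (phi psi : qformula s m) :
  qf_definable (fun t => qsat R phi t && qsat R psi t).
Proof.
have widen m' (chi : qformula s m') : exists chi' : qformula s m'.+1,
    forall (t : m'.-tuple A) a, qsat R chi' [tuple of rcons t a] = qsat R chi t.
  have [chi' chiP] := qf_rename chi (lift ord_max); exists chi' => t a.
  rewrite chiP; congr qsat; apply: eq_from_tnth => i.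
  by rewrite tnth_mktuple tnth_rcons_lift.
elim: phi psi => {m} m => [atoms|phi IH|phi IH] psi.
- elim: psi atoms => {m} m => [atoms'|psi IH|psi IH] atoms.
  + by exists (QConj (atoms ++ atoms')) => t /=; rewrite all_cat.
  + have [chi chiP] := IH [seq map_tuple (lift ord_max) v | v : s.-tuple 'I_m <- atoms].
    exists (QForall chi) => t /=; set X := all _ _.
    have XP a : qsat R chi [tuple of rcons t a] = X && qsat R psi [tuple of rcons t a].
      rewrite chiP /= all_map; congr (_ && _); apply: eq_all => v /=; congr (_ \in R).
      by apply: eq_from_tnth => i; rewrite !tnth_map tnth_rcons_lift.
    rewrite (eq_forallb XP); case: X {XP} => //=.
    by apply/negP => /forallP/(_ a0).
  + have [chi chiP] := IH [seq map_tuple (lift ord_max) v | v : s.-tuple 'I_m <- atoms].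
    exists (QExists chi) => t /=; set X := all _ _.
    have XP a : qsat R chi [tuple of rcons t a] = X && qsat R psi [tuple of rcons t a].
      rewrite chiP /= all_map; congr (_ && _); apply: eq_all => v /=; congr (_ \in R).
      by apply: eq_from_tnth => i; rewrite !tnth_map tnth_rcons_lift.
    rewrite (eq_existsb XP); case: X {XP} => //=.
    by apply/negbTE/existsPn => a.
- have [psi' psiP] := widen _ psi; have [chi chiP] := IH psi'.
  exists (QForall chi) => t /=.
  under eq_forallb => a do rewrite chiP psiP.
  case: (qsat R psi t); first by under eq_forallb => a do rewrite andbT; rewrite andbT.
  by rewrite andbF; apply/negP => /forallP/(_ a0); rewrite andbF.
- have [psi' psiP] := widen _ psi; have [chi chiP] := IH psi'.
  exists (QExists chi) => t /=.
  under eq_existsb => a do rewrite chiP psiP.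
  case: (qsat R psi t); first by under eq_existsb => a do rewrite andbT; rewrite andbT.
  by rewrite andbF; apply/negbTE/existsPn => a; rewrite andbF.
Qed.

(* A predicate over an arbitrary environment type [E], whose variables are the
   functions [E -> A] satisfying [X]; a quantifier extends the environment. *)
Definition bind (E : Type) (X : (E -> A) -> Prop) (v : E * A -> A) : Prop :=
  (exists2 v0, X v0 & v = v0 \o fst) \/ v = snd.

Inductive qdef : forall E : Type, ((E -> A) -> Prop) -> (E -> bool) -> Prop :=
| qdef_true E X : qdef X (fun _ : E => true)
| qdef_atom E X (vs : s.-tuple (E -> A)) : (forall i, X (tnth vs i)) ->
    qdef X (fun e => [tuple tnth vs i e | i < s] \in R)
| qdef_and E X (F F' : E -> bool) : qdef X F -> qdef X F' ->
    qdef X (fun e => F e && F' e)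
| qdef_forall E X (F : E * A -> bool) : qdef (bind X) F ->
    qdef X (fun e => [forall a, F (e, a)])
| qdef_exists E X (F : E * A -> bool) : qdef (bind X) F ->
    qdef X (fun e => [exists a, F (e, a)])
| qdef_eq E X (F F' : E -> bool) : F =1 F' -> qdef X F -> qdef X F'.

Lemma bind_env E (X : (E -> A) -> Prop) m (h : m.-tuple A -> E) :
  (forall v, X v -> exists i, forall t, v (h t) = tnth t i) ->
  exists2 h' : m.+1.-tuple A -> E * A,
    forall (t : m.-tuple A) a, h' [tuple of rcons t a] = (h t, a) &
    forall v, bind X v -> exists i, forall t, v (h' t) = tnth t i.
Proof.
move=> hX.
exists (fun t => (h [tuple tnth t (lift ord_max i) | i < m], tnth t ord_max)) => [t a|v].
  rewrite tnth_rcons_max; congr (h _, _); apply: eq_from_tnth => i.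
  by rewrite tnth_mktuple tnth_rcons_lift.
case=> [[v0 /hX[i iP] ->]|->]; last by exists ord_max.
by exists (lift ord_max i) => t; rewrite /= iP tnth_mktuple.
Qed.

(** [qdef] allows conjunctions above quantifiers; the prenex form is restored here by [qf_and]. *)
Lemma qdef_qf E X (F : E -> bool) m (h : m.-tuple A -> E) : qdef X F ->
  (forall v, X v -> exists i, forall t, v (h t) = tnth t i) ->
  qf_definable (fun t => F (h t)).
Proof.
move=> FX; elim: FX m h => {E X F}
  [E X|E X vs vX|E X F F' _ IH _ IH'|E X F _ IH|E X F _ IH|E X F F' eF _ IH] m h hX.
- by exists (QConj [::]).
- have /fin_all_exists[f fP] i := hX _ (vX i).
  exists (QConj [:: [tuple f i | i < s]]) => t /=; rewrite andbT; congr (_ \in R).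
  by apply: eq_from_tnth => i; rewrite tnth_map !tnth_mktuple fP.
- have [phi phiP] := IH _ _ hX; have [psi psiP] := IH' _ _ hX.
  by have [chi chiP] := qf_and phi psi; exists chi => t; rewrite chiP phiP psiP.
- have [h' h'E h'X] := bind_env hX.
  have [phi phiP] := IH _ _ h'X; exists (QForall phi) => t /=.
  by apply: eq_forallb => a; rewrite phiP h'E.
- have [h' h'E h'X] := bind_env hX.
  have [phi phiP] := IH _ _ h'X; exists (QExists phi) => t /=.
  by apply: eq_existsb => a; rewrite phiP h'E.
- by have [phi phiP] := IH _ _ hX; exists phi => t; rewrite phiP eF.
Qed.

Lemma qdef_q_definable m (P : {set m.-tuple A}) :
  qdef (fun v : m.-tuple A -> A => exists i, forall t, v t = tnth t i)
       (fun t => t \in P) -> q_definable R P.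
Proof.
move=> PX; have [|phi phiP] := @qdef_qf _ _ _ m id PX.
  by move=> v [i vi]; exists i.
by exists phi => t; rewrite phiP.
Qed.

Definition eval E (vs : seq (E -> A)) (e : E) : seq A := [seq v e | v <- vs].

Definition vars_in E (X : (E -> A) -> Prop) (vs : seq (E -> A)) : Prop :=
  forall i, i < size vs -> X (nth (fun=> a0) vs i).

Lemma size_eval E (vs : seq (E -> A)) e : size (eval vs e) = size vs.
Proof. exact: size_map. Qed.

Lemma vars_in_cat E (X : (E -> A) -> Prop) vs vs' :
  vars_in X vs -> vars_in X vs' -> vars_in X (vs ++ vs').
Proof.
move=> h h' i; rewrite size_cat nth_cat => iv; case: ltnP => [/h//|vi].
by apply: h'; rewrite ltn_subLR.
Qed.

Lemma vars_in1 E (X : (E -> A) -> Prop) v : X v -> vars_in X [:: v].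
Proof. by move=> Xv []. Qed.

Lemma vars_in_take E (X : (E -> A) -> Prop) vs i :
  vars_in X vs -> vars_in X (take i vs).
Proof.
move=> h j; rewrite size_take_min leq_min => /andP[ji jv].
by rewrite nth_take //; apply: h.
Qed.

Lemma qdef_holds E (X : (E -> A) -> Prop) vs : vars_in X vs -> size vs = s ->
  qdef X (fun e => holds R (eval vs e)).
Proof.
move=> vX /eqP sv; pose t := Tuple sv.
apply: qdef_eq (@qdef_atom _ X t _) => [e|i]; last first.
  by rewrite (tnth_nth (fun=> a0)); apply: vX; rewrite (eqP sv).
have eE : eval vs e = [tuple tnth t i e | i < s] :> seq A.
  rewrite /eval -[vs]/(tval t) -[in LHS](map_tnth_enum t) -map_comp.
  by [].
rewrite /holds; apply/idP/existsP => [tR|[t' /andP[tR /eqP tE]]].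
  by exists [tuple tnth t i e | i < s]; rewrite tR eE /=.
by rewrite (_ : [tuple _ | _ < _] = t') //; apply: val_inj; exact: etrans (esym eE) (esym tE).
Qed.

End Definability.

(** * Definability of constraints, supports and domains *)

Section Formulas.

Variables (A : finType) (a0 : A) (n : nat) (R : {set (2 * n).+1.-tuple A}).

Definition extends (E : Type) (X : (E -> A) -> Prop) (E' : Type)
    (X' : (E' -> A) -> Prop) (h : E' -> E) : Prop :=
  forall v, X v -> X' (v \o h).

Definition pull (E E' : Type) (h : E' -> E) (vs : seq (E -> A)) : seq (E' -> A) :=
  [seq v \o h | v <- vs].

(** Definability in every extension of the environment: [h] projects back to [E], while the
    arguments [vs] may use variables bound later. This is the form needed for the body of a
    quantifier. *)
Definition qdefs (E : Type) (X : (E -> A) -> Prop) r (F : E -> seq A -> bool) : Prop :=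
  forall E' (X' : (E' -> A) -> Prop) (h : E' -> E) vs, extends X X' h ->
    vars_in a0 X' vs -> size vs = r ->
    qdef R X' (fun e => F (h e) (eval vs e)).

Lemma eval_pull E E' (h : E' -> E) vs e : eval (pull h vs) e = eval vs (h e).
Proof. by rewrite /eval -map_comp. Qed.

Lemma size_pull E E' (h : E' -> E) (vs : seq (E -> A)) : size (pull h vs) = size vs.
Proof. exact: size_map. Qed.

Lemma vars_in_pull E E' (X : (E -> A) -> Prop) (X' : (E' -> A) -> Prop) (h : E' -> E) vs :
  extends X X' h -> vars_in a0 X vs -> vars_in a0 X' (pull h vs).
Proof.
move=> hX vX i; rewrite size_pull => iv.
by rewrite (nth_map (fun=> a0)) //; apply/hX/vX.
Qed.

Lemma extends_fst E (X : (E -> A) -> Prop) : extends X (bind X) fst.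
Proof. by move=> v Xv; left; exists v. Qed.

Lemma extends_comp E E' E'' (X : (E -> A) -> Prop) (X' : (E' -> A) -> Prop)
    (X'' : (E'' -> A) -> Prop) h h' :
  extends X X' h -> extends X' X'' h' -> extends X X'' (h \o h').
Proof. by move=> hX hX' v /hX/hX'. Qed.

Lemma qdef_all E (X : (E -> A) -> Prop) (T : Type) (F : T -> E -> bool) (s : seq T) :
  (forall x, List.In x s -> qdef R X (F x)) -> qdef R X (fun e => all (F ^~ e) s).
Proof.
elim: s => [|x s IH] H /=; first exact: qdef_true.
apply: qdef_and; first by apply: H; left.
by apply: IH => y ys; apply: H; right.
Qed.

Lemma qdef_ord E (X : (E -> A) -> Prop) m (F : 'I_m -> E -> bool) :
  (forall i, qdef R X (F i)) -> qdef R X (fun e => [forall i, F i e]).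
Proof.
move=> H; apply: qdef_eq (@qdef_all E X _ F (enum 'I_m) _) => [e|i _] //.
apply/allP/forallP => K i; first by apply: K; rewrite mem_enum.
by move=> _.
Qed.

Lemma qdef_ex1 E (X : (E -> A) -> Prop) (F : E -> A -> bool) :
  qdefs X 1 (fun e vs => F e (nth a0 vs 0)) -> qdef R X (fun e => [exists a, F e a]).
Proof.
move=> FX.
apply: qdef_eq (@qdef_exists _ _ R E X (fun p => F p.1 p.2) _) => //.
apply: (FX _ (bind X) fst [:: snd]) => //; first exact: extends_fst.
by apply: vars_in1; right.
Qed.

(** Relativizing a universal quantifier to a set would call for an implication. Over the values of
    listed variables it is a conjunction, and over everything an ordinary quantifier; no other
    ranges are needed. *)
Definition range E (o : option (seq (E -> A))) (e : E) : {set A} :=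
  if o is Some vs then [set a in eval vs e] else setT.

Definition range_in E (X : (E -> A) -> Prop) (o : option (seq (E -> A))) : Prop :=
  if o is Some vs then vars_in a0 X vs else True.

Definition pull_range E E' (h : E' -> E) (o : option (seq (E -> A))) :=
  omap (pull h) o.

Lemma range_pull E E' (h : E' -> E) o e : range (pull_range h o) e = range o (h e).
Proof. by case: o => [vs|] //=; rewrite eval_pull. Qed.

Lemma range_in_pull E E' (X : (E -> A) -> Prop) (X' : (E' -> A) -> Prop) (h : E' -> E) o :
  extends X X' h -> range_in X o -> range_in X' (pull_range h o).
Proof. by case: o => //= vs; apply: vars_in_pull. Qed.

Lemma qdef_forall_range E (X : (E -> A) -> Prop) o (F : E -> A -> bool) :
  range_in X o -> qdefs X 1 (fun e vs => F e (nth a0 vs 0)) ->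
  qdef R X (fun e => [forall a in range o e, F e a]).
Proof.
case: o => [vs|] /= vX FX; last first.
  apply: qdef_eq (@qdef_forall _ _ R E X (fun p => F p.1 p.2) _) => [e|].
    by apply: eq_forallb => a; rewrite inE.
  apply: (FX _ (bind X) fst [:: snd]) => //; first exact: extends_fst.
  by apply: vars_in1; right.
apply: qdef_eq (@qdef_ord E X (size vs) (fun i e => F e (nth (fun=> a0) vs i e)) _).
  move=> e; apply/forallP/forall_inP => [H a|H i].
    rewrite inE => /(nthP a0)[i]; rewrite size_eval => iv <-.
    by rewrite (nth_map (fun=> a0)) //; apply: (H (Ordinal iv)).
  by apply: H; rewrite inE; apply/(nthP a0); exists i; rewrite ?size_eval //
    (nth_map (fun=> a0)).
move=> i; apply: (FX E X id [:: nth (fun=> a0) vs i]) => //.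
by apply: vars_in1; apply: vX.
Qed.

Lemma qdef_ex_tuple r E (X : (E -> A) -> Prop) (F : E -> seq A -> bool) :
  qdefs X r F -> qdef R X (fun e => [exists y : r.-tuple A, F e y]).
Proof.
elim: r E X F => [|r IH] E X F FX.
  apply: qdef_eq (FX E X id [::] _ _ _) => // e; apply/idP/existsP => [H|[y]].
    by exists [tuple].
  by rewrite tuple0.
apply: qdef_eq (@qdef_exists _ _ R E X
    (fun p => [exists y : r.-tuple A, F p.1 (p.2 :: y)]) _) => [e|].
  apply/existsP/existsP => [[a /existsP[y yF]]|[y yF]].
    by exists [tuple of a :: y].
  exists (thead y); apply/existsP; exists [tuple of behead y].
  by rewrite (tuple_eta y) in yF.
apply: (IH _ _ (fun p y => F p.1 (p.2 :: y))) => E' X' h vs hX vX sv.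
apply: qdef_eq (FX E' X' (fst \o h) (snd \o h :: vs) _ _ _) => //=.
- by apply: extends_comp hX; apply: extends_fst.
- by case=> [_|i iv]; [apply: hX; right|apply: vX].
by rewrite sv.
Qed.

Lemma qdef_rSR E (X : (E -> A) -> Prop) rhos i ys xs :
  (forall i, range_in X (rhos i)) -> vars_in a0 X ys -> vars_in a0 X xs ->
  size ys = i.+1 -> size xs = i -> i <= n ->
  qdef R X (fun e => rSR R (fun i => range (rhos i) e) i (eval ys e) (eval xs e)).
Proof.
move=> rX yX xX sy sx le_in; rewrite /rSR; case: ltnP => [lt_in|le_ni]; last first.
  apply: qdef_eq (@qdef_holds _ a0 _ R E X (ys ++ xs) _ _) => [e||].
  - by rewrite /eval map_cat.
  - exact: vars_in_cat.
  - by rewrite size_cat sy sx; lia.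
apply: qdef_forall_range => // E1 X1 h1 [//|x1 [|//]] h1X x1X _.
apply: qdef_ex1 => E2 X2 h2 [//|y2 [|//]] h2X y2X _.
apply: qdef_eq (@qdef_forall_range E2 X2
  (pull_range (h1 \o h2) (rhos i.+1)) (fun e x' => [exists v : (n - i.+1).-tuple A,
     holds R (eval ys (h1 (h2 e)) ++ y2 e :: v ++ eval xs (h1 (h2 e)) ++
       x1 (h2 e) :: nseq (n - i.+1) x')]) _ _) => [e||].
- by rewrite range_pull.
- by apply: range_in_pull (rX _); apply: extends_comp h2X.
move=> E3 X3 h3 [//|x3 [|//]] h3X x3X _.
apply: (@qdef_ex_tuple _ _ _ (fun e (v : seq A) =>
  holds R (eval ys (h1 (h2 (h3 e))) ++ y2 (h3 e) :: v ++ eval xs (h1 (h2 (h3 e))) ++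
    x1 (h2 (h3 e)) :: nseq (n - i.+1) (x3 e)))) => E4 X4 h4 v4 h4X v4X sv4.
pose h := h1 \o h2 \o h3 \o h4.
have hX : extends X X4 h.
  exact: extends_comp (extends_comp (extends_comp h1X h2X) h3X) h4X.
have X4x (x : E1 -> A) : vars_in a0 X1 [:: x] -> X4 (x \o h2 \o h3 \o h4).
  by move=> x1X'; exact: (h4X _ (h3X _ (h2X _ (x1X' 0 isT)))).
apply: qdef_eq (@qdef_holds _ a0 _ R E4 X4 (pull h ys ++ (y2 \o h3 \o h4) :: v4 ++
   pull h xs ++ (x1 \o h2 \o h3 \o h4) :: nseq (n - i.+1) (x3 \o h4)) _ _) => [e||].
- rewrite /eval map_cat /= map_cat map_cat /= map_nseq -/(eval _ _).
  by rewrite -/(eval (pull h ys) e) -/(eval (pull h xs) e) !eval_pull.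
- apply: vars_in_cat; first exact: vars_in_pull hX yX.
  rewrite -cat1s; apply: vars_in_cat; first by apply: vars_in1; exact: (h4X _ (h3X _ (y2X 0 isT))).
  apply: vars_in_cat => //; apply: vars_in_cat; first exact: vars_in_pull hX xX.
  rewrite -cat1s; apply: vars_in_cat; first exact: vars_in1 (X4x _ x1X).
  by move=> p; rewrite size_nseq nth_nseq => ->; exact: (h4X _ (x3X 0 isT)).
by rewrite !(size_cat, size_pull, size_nseq) /= !(size_cat, size_pull) /= size_nseq; lia.
Qed.


Lemma eval_take E (vs : seq (E -> A)) i e : eval (take i vs) e = take i (eval vs e).
Proof. exact: map_take. Qed.

Lemma eval_nth E (vs : seq (E -> A)) i e :
  nth a0 (eval vs e) i = nth (fun=> a0) vs i e.
Proof.
have [iv|vi] := ltnP i (size vs); first by rewrite (nth_map (fun=> a0)).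
by rewrite !nth_default ?size_eval.
Qed.

Lemma qdef_path_sat E (X : (E -> A) -> Prop) rhos ws ys :
  (forall i, range_in X (rhos i)) -> vars_in a0 X ys -> vars_in a0 X ws ->
  size ys = (size ws).+1 -> size ws <= n ->
  qdef R X (fun e => path_sat R (fun i => range (rhos i) e) (eval ws e) (eval ys e)).
Proof.
move=> rX yX wX sy wn.
apply: qdef_eq (@qdef_ord E X (size ws).+1 (fun i e =>
  rSR R (fun i => range (rhos i) e) i (eval (take i.+1 ys) e) (eval (take i ws) e)) _).
  move=> e; apply/forallP/path_satP => H i.
    rewrite size_eval => iw; have := H (Ordinal (iw : i < (size ws).+1)).
    by rewrite /= !eval_take.
  by rewrite !eval_take; apply: H; rewrite size_eval -ltnS.
move=> i; apply: qdef_rSR => //; try exact: vars_in_take.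
- by rewrite size_takel // sy.
- by rewrite size_takel // -ltnS.
by apply: leq_trans wn; rewrite -ltnS.
Qed.

Definition fix_vars (T : Type) (x0 : T) i (b : T) p (a : T) m (y : seq T) : seq T :=
  mkseq (fun j => if j == i then b else if j == p then a else nth x0 y j) m.

Lemma eval_fix_vars E i b p a m (ys : seq (E -> A)) e :
  eval (fix_vars (fun=> a0) i b p a m ys) e =
  fix_vars a0 i (b e) p (a e) m (eval ys e).
Proof.
rewrite /eval /fix_vars /mkseq -map_comp; apply: eq_map => j /=.
by do 2!case: ifP => // _; rewrite eval_nth.
Qed.

(* Equality is not an atom, so the fixed entries of the tuple are substituted. *)
Lemma qdef_supported E (X : (E -> A) -> Prop) rhos ws i b p a
    (S : nat -> E -> seq A -> {set A}) :
  (forall i, range_in X (rhos i)) -> vars_in a0 X ws -> size ws <= n ->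
  i <= size ws -> i != p -> X b -> X a ->
  (forall j E' (X' : (E' -> A) -> Prop) (h : E' -> E) us v,
     j <= size ws -> extends X X' h -> vars_in a0 X' us -> size us = j -> X' v ->
     qdef R X' (fun e => v e \in S j (h e) (eval us e))) ->
  qdef R X (fun e => supported a0 R (fun i => range (rhos i) e)
    (fun j u => if j == p then [set a e] else S j e u) (eval ws e) i (b e)).
Proof.
move=> rX wX wn iw ip Xb Xa SX; set m := (size ws).+1.
pose G e y := path_sat R (fun i => range (rhos i) e) (eval ws e) y &&
  [forall j : 'I_m, (val j == p) || (nth a0 y j \in S j e (take j (eval ws e)))].
pose fx e y := fix_vars a0 i (b e) p (a e) m y.
apply: qdef_eq (@qdef_ex_tuple m E X (fun e y => G e (fx e y)) _) => [e|].
  apply/existsP/supportedP => [[y /andP[yw /forallP yS]]|[y [sy yb yw yS]]].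
    exists (fx e y); split=> //; first by rewrite size_mkseq size_eval.
      by rewrite nth_mkseq ?eqxx.
    move=> j; rewrite size_eval => jw; have := yS (Ordinal (jw : j < m)).
    rewrite /=; case: eqP => //= jp _; rewrite nth_mkseq // jp eqxx eq_sym (negbTE ip).
    by rewrite inE.
  rewrite !size_eval in sy yS; have sy' : size y == m by apply/eqP.
  exists (Tuple sy'); have -> : fx e (Tuple sy') = y.
    apply: (@eq_from_nth _ a0) => [|j]; rewrite size_mkseq // => jm.
    rewrite nth_mkseq //; case: eqP => [->|_] //; case: eqP => // jp.
    by have := yS j jm; rewrite jp eqxx inE => /eqP.
  rewrite /G yw; apply/forallP => j; have := yS j (leq_ord j).
  by case: eqP.
move=> E1 X1 h ys hX yX sy.
pose zs := fix_vars (fun=> a0) i (b \o h) p (a \o h) m ys.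
have zX : vars_in a0 X1 zs.
  move=> j; rewrite size_mkseq => jm; rewrite nth_mkseq //.
  do 2![case: ifP => _; first exact: hX]; apply: yX; rewrite sy.
  exact: jm.
have zE e : eval zs e = fx (h e) (eval ys e) by rewrite eval_fix_vars.
pose G1 e := path_sat R (fun i => range (pull_range h (rhos i)) e) (eval (pull h ws) e) (eval zs e).
pose G2 e := [forall j : 'I_m, (val j == p) ||
  (nth (fun=> a0) zs j e \in S j (h e) (eval (take j (pull h ws)) e))].
apply: qdef_eq (@qdef_and _ _ R E1 X1 G1 G2 _ _) => [e||].
- rewrite /G1 /G2 /G zE eval_pull; congr (_ && _).
    by apply/idP/idP; apply: path_sat_anti => j; rewrite range_pull.
  apply: eq_forallb => j; rewrite -eval_nth zE eval_take eval_pull.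
  by [].
- apply: qdef_path_sat => //; rewrite ?size_pull //.
  + by move=> j; apply: range_in_pull hX (rX j).
  + exact: vars_in_pull hX wX.
  + by rewrite size_mkseq.
apply: qdef_ord => j; case: (val j == p).
  exact: qdef_true.
apply: SX => //.
- by rewrite -ltnS.
- exact: vars_in_take (vars_in_pull hX wX).
- by rewrite size_takel // size_pull -ltnS.
by apply: zX; rewrite size_mkseq.
Qed.

Lemma qdef_all_ext r E (X : (E -> A) -> Prop) rhos us (F : E -> seq A -> bool) :
  (forall i, range_in X (rhos i)) -> vars_in a0 X us ->
  qdefs X (size us + r) F ->
  qdef R X (fun e => all_ext (fun i => range (rhos i) e) r (eval us e) (F e)).
Proof.
elim: r E X rhos us F => [|r IH] E X rhos us F rX uX FX /=.
  by apply: FX => //; rewrite addn0.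
apply: qdef_eq (@qdef_forall_range E X (rhos (size us)) (fun e x =>
  all_ext (fun i => range (rhos i) e) r (rcons (eval us e) x) (F e)) _ _) => //.
  by move=> e; rewrite size_eval.
move=> E1 X1 h [//|x [|//]] hX xX _.
apply: qdef_eq (IH E1 X1 (fun i => pull_range h (rhos i)) (rcons (pull h us) x)
  (fun e => F (h e)) _ _ _) => [e|i||].
- rewrite /eval map_rcons -/(eval _ _) eval_pull.
  by apply/idP/idP => /all_extP H; apply/(all_extP a0) => y sy yr;
     apply: (H a0) => // i ir; have := yr i ir; rewrite range_pull.
- exact: range_in_pull hX (rX i).
- by rewrite -cats1; apply: vars_in_cat => //; apply: vars_in_pull hX uX.
move=> E2 X2 h2 ws h2X wX; rewrite size_rcons size_pull addSnnS => sw.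
by apply: (FX E2 X2 (h \o h2)) => //; apply: extends_comp h2X.
Qed.

Variable lev : nat -> nat.

Lemma eq_range_acons rho rho' t d u : rho =1 rho' ->
  acons a0 R rho lev t d u = acons a0 R rho' lev t d u.
Proof. by move=> e; apply/eqP; rewrite eqEsubset !acons_anti // => i; rewrite e. Qed.

Lemma qdef_acons t d E (X : (E -> A) -> Prop) rhos us v :
  (forall i, i < t -> lev i <= n) ->
  (forall i, range_in X (rhos i)) -> vars_in a0 X us -> X v ->
  qdef R X (fun e => v e \in acons a0 R (fun i => range (rhos i) e) lev t d (eval us e)).
Proof.
elim: t d E X rhos us v => [|t IH] [|d] E X rhos us v levn rX uX vX;
  try by apply: qdef_eq (@qdef_true _ _ R E X) => e; rewrite /= inE.
have levt i : i < t -> lev i <= n by move=> it; apply: levn; apply: ltnW.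
pose F e w := supported a0 R (fun i => range (rhos i) e)
  (fun=> acons a0 R (fun i => range (rhos i) e) lev t d) w (size us) (v e).
have {}IH2 := IH d.+1 E X rhos us v levt rX uX vX.
have [tu|ut] := ltnP (lev t) (size us).
  by apply: qdef_eq IH2 => e; rewrite /= inE size_eval tu andbT.
apply: qdef_eq (qdef_and IH2 (@qdef_all_ext (lev t - size us) E X rhos us F _ _ _)) => //.
  by move=> e; rewrite /= inE size_eval ltnNge ut.
move=> E1 X1 h ws hX wX; rewrite subnKC // => sw.
(* The position [(size ws).+1] lies beyond the tuple, so the second fixed entry is a dummy. *)
apply: qdef_eq (@qdef_supported E1 X1 (fun i => pull_range h (rhos i)) ws (size us)
  (v \o h) (size ws).+1 (v \o h) (fun _ e => acons a0 R
     (fun i => range (pull_range h (rhos i)) e) lev t d) _ _ _ _ _ _ _ _) => //.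
- move=> e; apply/idP/idP; apply: supported_mono => [i|j jw].
  + by rewrite range_pull.
  + rewrite ltn_eqF; last by rewrite size_eval in jw.
    by apply: acons_anti => i; rewrite range_pull.
  + by rewrite range_pull.
  rewrite ltn_eqF; last by rewrite size_eval in jw.
  by apply: acons_anti => i; rewrite range_pull.
- by move=> i; apply: range_in_pull hX (rX i).
- by rewrite sw levn.
- by rewrite sw.
- by rewrite sw; lia.
- exact: hX.
- exact: hX.
move=> j E2 X2 h2 us2 v2 _ h2X u2X _ v2X.
apply: qdef_eq (IH d E2 X2 (fun i => pull_range h2 (pull_range h (rhos i))) us2 v2 _ _ _ _) => //.
  by move=> e; rewrite (@eq_range_acons _ (fun i => range (pull_range h (rhos i)) (h2 e))) // => i;
     rewrite range_pull.
by move=> i; apply/(range_in_pull h2X)/(range_in_pull hX).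
Qed.

End Formulas.

(** * Definability and composition of links *)

Section LinkFormulas.

Variables (k n : nat) (R : {set (2 * n).+1.-tuple 'I_k}) (a0 : 'I_k).
Variables (lev : nat -> nat) (t0 : nat).
Hypothesis levn : forall i, i < t0 -> lev i <= n.

Local Notation A := 'I_k.
Local Notation whole := (@whole A).
Local Notation link := (link R a0 lev).
Local Notation reach := (reach R a0 lev).
Local Notation supported := (supported a0 R).

Implicit Types (z : k.-tuple A) (e : edge k) (es l : seq (edge k)).

(** The positions must differ because source and target values are substituted for two entries of
    one tuple, and without equality they could not be identified. *)
Definition well_formed e : Prop :=
  exists t u, [/\ edge_ok lev e t u, t <= t0 & e_pos e != size (e_tgt e)].

Lemma es_time_le top es : chain_ok R a0 lev t0 top es -> es_time t0 es <= t0.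
Proof.
elim: es => //= e es IH [/edge_okP[[_ _ et] _ _ _] _ _ _ /IH].
by move/(leq_trans (ltnW et)).
Qed.

Lemma chain_well_formed top es : chain_ok R a0 lev t0 top es ->
  forall i e, i < size es -> well_formed (nth e es i).
Proof.
elim: es => //= e es IH [eok ep _ _ esok] [|i] e' ie /=.
  by exists (es_time t0 es), (es_src top es); split=> //; apply: es_time_le esok.
exact: IH.
Qed.

Section Environment.

Variables (E : Type) (X : (E -> A) -> Prop).
Variables (rhos : nat -> option (seq (E -> A))) (zt : E -> k.-tuple A).
Hypothesis rX : forall i, range_in a0 X (rhos i).
Hypothesis zX : forall i, X (fun g => tnth (zt g) i).

Local Notation rho := (fun g i => range (rhos i) g).

Let zvars (u : seq A) : seq (E -> A) := [seq (fun g => tnth (zt g) i) | i <- u].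

Let zvarsX u : vars_in a0 X (zvars u).
Proof.
move=> i; rewrite size_map => iu.
by rewrite (nth_map a0); first exact: zX.
Qed.

Let eval_zvars u g : eval (zvars u) g = value (zt g) u.
Proof. by rewrite /eval -map_comp. Qed.

Lemma qdef_link e a b : well_formed e -> X a -> X b ->
  qdef R X (fun g => link (rho g) e (zt g) (a g) (b g)).
Proof.
case=> t [u [eok tt0 ep]] Xa Xb; case/edge_okP: eok => [[eu et etau] [sw uw wu] pw ed].
have levb i : i < e_bound e -> lev i <= n by rewrite et => it; apply: levn; lia.
have levt i : i < e_time e -> lev i <= n by move=> it; apply: levb; rewrite et; lia.
have wn : size (e_path e) <= n by rewrite sw levb // et.
have acX E' (X' : (E' -> A) -> Prop) rhos' us v d t' : t' <= e_bound e ->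
    (forall i, range_in a0 X' (rhos' i)) -> vars_in a0 X' us -> X' v ->
    qdef R X' (fun g => v g \in acons a0 R (fun i => range (rhos' i) g) lev t' d (eval us g)).
  by move=> tb rX' uX vX; apply: qdef_acons => // i it; apply: levb; lia.
have taub : e_time e <= e_bound e by rewrite et ltnW.
rewrite /link.
apply: qdef_and.
  by apply: qdef_eq (acX E X rhos (zvars (e_tgt e)) b (e_time e) _ taub rX (@zvarsX _) Xb) => g;
     rewrite eval_zvars.
apply: qdef_and.
  by apply: qdef_eq (acX E X rhos (zvars (e_tgt e)) b (e_depth e).+1 _ (leqnn _) rX (@zvarsX _) Xb) => g;
     rewrite eval_zvars.
have acS d d' j E' (X' : (E' -> A) -> Prop) (h : E' -> E) us v :
    extends X X' h -> vars_in a0 X' us -> X' v ->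
    qdef R X' (fun g => v g \in (if j < e_pos e then
       acons a0 R (rho (h g)) lev (e_time e) d (eval us g) else
       acons a0 R (rho (h g)) lev (e_time e) d' (eval us g))).
  move=> hX uX vX.
  have acd d0 : qdef R X' (fun g => v g \in
      acons a0 R (rho (h g)) lev (e_time e) d0 (eval us g)).
    apply: qdef_eq (acX E' X' (fun i => pull_range h (rhos i)) us v d0 _ taub
      (fun i => range_in_pull hX (rX i)) uX vX) => g.
    by rewrite (@eq_range_acons _ _ _ _ _ _ (rho (h g))) // => i; rewrite range_pull.
  by case: (j < e_pos e).
apply: qdef_and.
  apply: qdef_all => w wd.
  have {}wd : w \in e_done e.
    by elim: (e_done e) wd => //= x s IH [->|/IH ws]; rewrite inE ?eqxx ?ws ?orbT.
  have [sw' uw' wu'] := ed w wd.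
  pose S (j : nat) g u := acons a0 R (rho g) lev (e_time e) (e_time e) u.
  apply: qdef_eq (@qdef_supported _ a0 n R E X rhos (zvars w) (size (e_tgt e)) b
    (size w).+1 b S rX (@zvarsX w) _ _ _ Xb Xb _) => [g||||].
  - rewrite eval_zvars.
    apply/idP/idP; apply: supported_mono => // j; rewrite size_value => jw;
    by rewrite ltn_eqF.
  - by rewrite size_map sw' levb // et.
  - by rewrite size_map eu.
  - by rewrite eu; lia.
  move=> j E' X' h us v _ hX uX _ vX; have := acS (e_time e) (e_time e) 0 E' X' h us v hX uX vX.
  by apply: qdef_eq => g; case: ifP.
pose S j g u := if j < e_pos e then acons a0 R (rho g) lev (e_time e) (e_time e) u
  else acons a0 R (rho g) lev (e_time e) (e_depth e) u.
apply: qdef_eq (@qdef_supported _ a0 n R E X rhos (zvars (e_path e)) (size (e_tgt e)) b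
  (e_pos e) a S rX (@zvarsX _) _ _ _ Xb Xa _) => [g||||].
- rewrite eval_zvars.
  by apply/idP/idP; apply: supported_mono => // j _; rewrite /side /S; case: ltngtP.
- by rewrite size_map.
- by rewrite size_map eu.
- by rewrite eq_sym.
by move=> j E' X' h us v _ hX uX _ vX; apply: acS.
Qed.

End Environment.

Lemma qdef_reach E (X : (E -> A) -> Prop) zt es a :
  (forall i, X (fun g => tnth (zt g) i)) -> X a ->
  (forall i e, i < size es -> well_formed (nth e es i)) ->
  qdef R X (fun g => a g \in reach es (zt g)).
Proof.
elim: es E X zt a => [|e es IH] E X zt a zX Xa wf /=.
  by apply: qdef_eq (@qdef_true _ _ R E X) => g; rewrite inE.
apply: qdef_eq (@qdef_ex1 _ a0 n R E X
  (fun g b => (b \in reach es (zt g)) && link whole e (zt g) (a g) b) _) => [g|].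
  by rewrite inE.
move=> E' X' h [//|b [|//]] hX bX _ /=.
have zX' i : X' (fun g => tnth (zt (h g)) i) by apply: (hX _ (zX i)).
apply: qdef_and; first by apply: IH => // [|i e' ie]; [apply: (bX 0)|apply: (wf i.+1)].
apply: (@qdef_link E' X' (fun=> None) (fun g => zt (h g)) _ _ e (a \o h) b) => //.
- by apply: (wf 0 e).
- exact: hX.
exact: (bX 0).
Qed.

Definition forward z (U : {set A}) e : {set A} :=
  [set b | [exists a in U, link whole e z a b]].

Definition backward z e (U : {set A}) : {set A} :=
  [set a | [exists b in U, link whole e z a b]].

Fixpoint segment (rho : nat -> {set A}) e l z (a b : A) : bool :=
  if l is e' :: l' then
    [exists c, link rho e z a c && segment rho e' l' z c b]
  else link rho e z a b.

(** Turns a repetition of the forward set into invariance under the composite relation. *)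
Lemma segment_forward z e l (U : {set A}) :
  [set b | [exists a in U, segment whole e l z a b]] = foldl (forward z) U (e :: l).
Proof.
elim: l e U => [|e' l IH] e U //=; rewrite -[RHS]IH; apply/setP => b; rewrite !inE.
apply/exists_inP/exists_inP => [[a aU /existsP[c /andP[ac cb]]]|[c]].
  by exists c => //; rewrite inE; apply/exists_inP; exists a.
rewrite inE => /exists_inP[a aU ac] cb; exists a => //.
by apply/existsP; exists c; rewrite ac.
Qed.

Lemma segment_backward z e l (U : {set A}) :
  [set a | [exists b in U, segment whole e l z a b]] = foldr (backward z) U (e :: l).
Proof.
elim: l e => [|e' l IH] e //=; rewrite -[foldr _ _ l]/(foldr _ _ l).
rewrite -/(foldr (backward z) U (e' :: l)) -IH; apply/setP => a; rewrite !inE.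
apply/exists_inP/exists_inP => [[b bU /existsP[c /andP[ac cb]]]|[c]].
  by exists c => //; rewrite inE; apply/exists_inP; exists b.
rewrite inE => /exists_inP[b bU cb] ac; exists b => //.
by apply/existsP; exists c; rewrite ac.
Qed.

Lemma reach_cat l es z : reach (l ++ es) z = foldr (backward z) (reach es z) l.
Proof. by elim: l => //= e l ->. Qed.

Lemma link_anti (rho rho' : nat -> {set A}) e z a b : (forall i, rho i \subset rho' i) ->
  link rho' e z a b -> link rho e z a b.
Proof.
move=> sr /and4P[h1 h2 /allP h3 h4]; apply/and4P; split.
- exact: subsetP (acons_anti _ _ _ _ _ _ sr) _ h1.
- exact: subsetP (acons_anti _ _ _ _ _ _ sr) _ h2.
- apply/allP => w /h3; apply: supported_mono => // j _; exact: acons_anti.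
apply: supported_mono h4 => // j _; rewrite /side.
by case: ifP => _; [|case: ifP => _]; rewrite ?subxx ?acons_anti.
Qed.

Lemma segment_anti (rho rho' : nat -> {set A}) e l z a b : (forall i, rho i \subset rho' i) ->
  segment rho' e l z a b -> segment rho e l z a b.
Proof.
move=> sr; elim: l e a => [|e' l IH] e a /=; first exact: link_anti.
case/existsP => c /andP[ac cb]; apply/existsP; exists c.
by rewrite (link_anti sr ac) IH.
Qed.

Lemma qdef_segment E (X : (E -> A) -> Prop) rhos zt e l a b :
  (forall i, range_in a0 X (rhos i)) -> (forall i, X (fun g => tnth (zt g) i)) ->
  X a -> X b -> (forall i e', i < size (e :: l) -> well_formed (nth e' (e :: l) i)) ->
  qdef R X (fun g => segment (fun i => range (rhos i) g) e l (zt g) (a g) (b g)).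
Proof.
elim: l E X rhos zt e a b => [|e' l IH] E X rhos zt e a b rX zX Xa Xb wf /=.
  by apply: qdef_link => //; apply: (wf 0 e).
apply: (@qdef_ex1 _ a0 n R E X (fun g c => link (fun i => range (rhos i) g) e (zt g) (a g) c &&
  segment (fun i => range (rhos i) g) e' l (zt g) c (b g))).
move=> E' X' h [//|c [|//]] hX cX _ /=.
have zX' i : X' (fun g => tnth (zt (h g)) i) by apply: (hX _ (zX i)).
have rX' i : range_in a0 X' (pull_range h (rhos i)) by apply: range_in_pull hX (rX i).
apply: qdef_and.
  apply: qdef_eq (@qdef_link E' X' (fun i => pull_range h (rhos i)) (fun g => zt (h g))
    rX' zX' e (a \o h) c _ _ _) => [g|||].
  - by apply/idP/idP; apply: link_anti => i; rewrite range_pull.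
  - exact: (wf 0 e).
  - exact: hX.
  exact: (cX 0).
apply: qdef_eq (IH E' X' (fun i => pull_range h (rhos i)) (fun g => zt (h g)) e' c (b \o h)
  rX' zX' _ _ _) => [g|||].
- by apply/idP/idP; apply: segment_anti => i; rewrite range_pull.
- exact: (cX 0).
- exact: hX.
by move=> i e'' ie; apply: (wf i.+1).
Qed.

End LinkFormulas.

(** * Crossing from B to C *)

Section Crossing.

Variables (k n : nat) (R : {set (2 * n).+1.-tuple 'I_k}) (a0 : 'I_k).
Variables (lev : nat -> nat) (t0 : nat).
Hypothesis levn : forall i, i < t0 -> lev i <= n.
Hypothesis levst : forall t i, t < t0 -> i < lev t ->
  stable_at a0 R i (dom a0 R lev t).

Local Notation A := 'I_k.
Local Notation whole := (@whole A).
Local Notation link := (link R a0 lev).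
Local Notation reach := (reach R a0 lev).
Local Notation segment := (segment R a0 lev).
Local Notation forward := (forward R a0 lev).
Local Notation backward := (backward R a0 lev).
Local Notation supported := (supported a0 R).
Local Notation chain_ok := (chain_ok R a0 lev t0).
Local Notation edge_ok := (edge_ok lev).
Local Notation dom := (dom a0 R lev).
Local Notation acons rho := (acons a0 R rho lev).
Implicit Types (z : k.-tuple A) (e : edge k) (es l : seq (edge k)) (x : A).

Lemma chain_nth top es i e0 : chain_ok top es -> i.+1 < size es ->
  let e := nth e0 es i in let e' := nth e0 es i.+1 in
  [/\ edge_ok e (e_time e') (e_src e'), size (e_tgt e) < size (e_path e) &
      forall z, reach (drop i.+1 es) z :&: dom (e_time e) (value z (e_tgt e)) != set0].
Proof.
elim: es i => // e es IH [|i] [eok _ eD esz esok] /= ie; last exact: IH.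
by case: (es) eok eD esz ie => // e' es' eok eD esz _; rewrite drop0; split=> //; apply: esz.
Qed.

(** The start is the final domain at the newest source, which [pending] makes disjoint from the
    backward set at some parameter. *)
Definition front es z i : {set A} :=
  if es is e :: _ then
    foldl (forward z) (dom (e_time e) (value z (e_src e))) (take i es)
  else set0.

Lemma front_split es z i j : front es z (i + j) = foldl (forward z) (front es z i) (take j (drop i es)).
Proof.
by rewrite /front; case: es => [|e es]; rewrite ?takeD ?foldl_cat //= /forward; case: i.
Qed.

Lemma frontS es z i e0 : i < size es ->
  front es z i.+1 = forward z (front es z i) (nth e0 es i).
Proof.
move=> ie; rewrite -addn1 front_split (drop_nth e0) //= take0.
by [].
Qed.

(** A value that survives past the step of the link is supported by final domains, and these lie
    inside all the sets that the link mentions. *)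
Lemma link_dom e t u z b : edge_ok e t u -> b \in dom t (value z u) ->
  exists2 a, a \in dom (e_time e) (value z (e_src e)) & link whole e z a b.
Proof.
case/edge_okP => -[eu et tt] [sw uw wu] pw ed bD.
have bD1 := subsetP (dom_le _ _ _ _ tt) _ bD.
have sup w : size w = lev (e_time e) -> size u <= size w -> take (size u) w = u ->
    supported whole (fun=> dom (e_time e)) (value z w) (size u) b.
  move=> sw' uw' wu'; have /domS[_ /(_ (value z w))] := bD1.
  by rewrite !size_value -value_take wu'; apply.
have /supportedP[y [sy yb yw yD]] := sup _ sw uw wu.
exists (nth a0 y (e_pos e)).
  by rewrite value_take; apply: yD; rewrite size_value.
rewrite /link eu et; apply/and4P; split.
- exact: (subsetP (dom_le _ _ _ _ (ltnW tt))).
- exact: (subsetP (dom_acons _ _ _ _ _ (leqnn _))).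
- by apply/allP => w /ed[*]; apply: sup.
apply/supportedP; exists y; split=> // i iw; have := yD i iw; rewrite /side.
case: ltngtP => [//|pi|<- _]; last by rewrite inE.
exact: (subsetP (dom_acons _ _ _ _ _ (leqnn _))).
Qed.

Lemma front_dom top es z i e0 : chain_ok top es -> i < size es ->
  dom (e_time (nth e0 es i)) (value z (e_src (nth e0 es i))) \subset front es z i.
Proof.
move=> esok; elim: i => [|i IH] ie; first by case: es {esok} ie => //= e es _; rewrite take0.
apply/subsetP => b bD; rewrite (frontS z e0) ?(ltnW ie) // inE.
have [eok _ _] := chain_nth e0 esok ie.
have [a aD ab] := link_dom eok bD; apply/exists_inP; exists a => //.
exact: (subsetP (IH (ltnW ie))).
Qed.

(** A common value after a link pulls back along that link to a common value before it. *)
Lemma front_reach es z i : i <= size es -> front es z 0 :&: reach es z = set0 ->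
  front es z i :&: reach (drop i es) z = set0.
Proof.
move=> ie; elim: i ie => [|i IH] ie H; first by rewrite drop0.
have e0 : edge k by case: es ie {IH H}.
apply/setP => b; rewrite in_set0; apply/negP; rewrite (frontS z e0) // inE.
rewrite inE => /andP[/exists_inP[a aF ab] bR].
have := in_set0 a; rewrite -(IH (ltnW ie) H) inE aF (drop_nth e0) //= inE.
by move/negbT/negP; case; apply/exists_inP; exists b.
Qed.

Section Relaxed.

Variables (j : nat) (G : seq A -> {set A}) (x : A).
Hypothesis jn : j <= n.
Hypothesis Gst : forall i, i < j -> stable_at a0 R i G.

Lemma short_good z w : size w <= j -> good a0 j x (value z w).
Proof. by move=> wj i; rewrite size_value => /andP[ji /leq_trans/(_ wj)]; rewrite ltnNge ji. Qed.

(** Under relaxation b lies in the hull and so survives all steps before [t0]. The conditions of the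
    link on b alone are then automatic, even for times later than that of [G]; only the tuple along
    the path has to be supplied. *)
Lemma relaxed_link e t u z y a b : edge_ok e t u -> t <= t0 ->
  size (e_path e) <= j -> size u < j -> b \in G (value z u) ->
  size y = (size (e_path e)).+1 -> nth a0 y (size u) = b -> nth a0 y (e_pos e) = a ->
  path_sat R (cut j [set x]) (value z (e_path e)) y ->
  (forall i d, i <= size (e_path e) ->
     nth a0 y i \in acons (cut j [set x]) (e_time e) d (take i (value z (e_path e)))) ->
  link (cut j [set x]) e z a b.
Proof.
case/edge_okP => -[eu et tt] [sw uw wu] pw ed tt0 wj uj bG sy yb ya yw yD.
have bH : b \in hull a0 R j G x (value z u).
  by rewrite hull_small ?size_value.
have levt i : i < t -> lev i <= n by move=> it; apply: levn; apply: leq_trans tt0.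
have levtau i : i < e_time e -> lev i <= n by move=> it; apply: levt; apply: ltn_trans tt.
have ac t' d : (forall i, i < t' -> lev i <= n) ->
    b \in acons (cut j [set x]) t' d (value z u).
  move=> lt'; apply: (subsetP (hull_acons jn Gst d lt' _ _)) bH.
    by rewrite size_value; lia.
  by apply: short_good; apply: ltnW.
rewrite /link eu et ac // ac //=; apply/andP; split.
  apply/allP => w /ed[sw' uw' wu'].
  have wj' : size w <= j by rewrite sw' -sw.
  have := hull_supported_acons jn Gst (e_time e) levtau (_ : size (value z w) <= n)
    (short_good wj') _ _ bH.
  by rewrite !size_value -value_take wu'; apply=> //; apply: leq_trans jn.
apply/supportedP; exists y; rewrite size_value; split=> // i iw; rewrite /side.
have yDi d := yD i d iw.
by case: ltngtP => [//|//|->]; rewrite ya inE.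
Qed.

End Relaxed.

(* A link whose source lies above the end of its path can be crossed alone.  Below
   a link whose source is the end of its path, values have already been supported
   along the longer path of the preceding link, which contains both links. *)
Lemma crossing top es p e0 : chain_ok top es -> p.+2 < size es ->
  exists j, forall z, exists a b, [/\ a \in front es z p,
    b \in reach (drop p.+2 es) z &
    forall x, exists2 c, link (cut j [set x]) (nth e0 es p) z a c &
                         link (cut j [set x]) (nth e0 es p.+1) z c b].
Proof.
move=> esok pe.
have [eok1 uw1 _] := chain_nth e0 esok (ltnW pe).
have [eok2 uw2 reach2] := chain_nth e0 esok pe.
have esok' : forall i, i < size es -> e_time (nth e0 es i) < t0.
  move=> i ie; have [t [u [/edge_okP[[_ _ tt] _ _ _] tt0 _]]] := chain_well_formed esok e0 ie.
  exact: leq_trans tt tt0.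
set e1 := nth e0 es p in eok1 uw1 *; set e2 := nth e0 es p.+1 in eok1 uw2 eok2 reach2 *.
set e3 := nth e0 es p.+2 in eok2.
have t3 : e_time e3 <= t0 by apply/ltnW/esok'.
have t2 : e_time e2 <= t0 by apply/ltnW/esok'/ltnW.
have t1 : e_time e1 < t0 by apply/esok'/ltnW/ltnW.
case/edge_okP: (eok1) => -[eu1 _ tt1] [sw1 _ wu1] pw1 _.
case/edge_okP: (eok2) => -[eu2 _ tt2] [sw2 _ wu2] pw2 _.
have wn1 : size (e_path e1) <= n by rewrite sw1 levn.
have wn2 : size (e_path e2) <= n by rewrite sw2 levn //; apply: leq_trans tt2 t3.
have [lt2|ge2] := ltnP (e_pos e2) (size (e_path e2)).
  exists (size (e_path e2)) => z; pose G := dom (e_time e2); pose j := size (e_path e2).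
  have Gst i : i < j -> stable_at a0 R i G.
    by rewrite /j sw2; apply: levst; apply: leq_trans tt2 t3.
  have /set0Pn[b] := reach2 z; rewrite inE => /andP[bR bG].
  have j0 : 0 < j by apply: leq_ltn_trans uw2.
  (* The support of b is taken along the path shortened to depth j - 1, which still contains the
     source position. Hence the source value [a2] is fixed before x, and only the entry at depth j
     depends on x. *)
  pose w0 := take j.-1 (value z (e_path e2)).
  have sw0 : size w0 = j.-1 by rewrite size_takel // size_value; apply: leq_pred.
  have uj : size (e_tgt e2) <= j.-1 by rewrite -ltnS prednK.
  have w0u : take (size (e_tgt e2)) w0 = value z (e_tgt e2).
    by rewrite take_takel // -value_take eu2 wu2.
  have /supportedP[y [sy yb yw yG]] : supported whole (fun=> G) w0 (size (e_tgt e2)) b.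
    apply: (Gst j.-1) => //; first by rewrite prednK.
    by rewrite w0u.
  rewrite sw0 prednK // in sy yG.
  have yGj i : i < j -> nth a0 y i \in G (take i (value z (e_path e2))).
    move=> ij; have ij' : i <= j.-1 by rewrite -ltnS prednK.
    by have := yG i ij'; rewrite take_takel.
  pose a2 := nth a0 y (e_pos e2).
  have a2F : a2 \in front es z p.+1.
    apply: (subsetP (front_dom z e0 esok _)); first exact: ltnW.
    by rewrite value_take; apply: yGj.
  move: (a2F); rewrite (frontS z e0); last exact/ltnW/ltnW.
  rewrite inE => /exists_inP[a aF aa2].
  exists a, b; split=> // x; exists a2.
    by apply: link_anti aa2 => i; apply: cut_whole.
  have gw : good a0 j x (value z (e_path e2)) by apply: short_good.
  have [] := @hull_extend _ a0 n R j G x wn2 y (value z (e_path e2)) j0 gw _ sy yw yGj.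
    by rewrite size_value leqnn.
  move=> y' [sy' ty' yw' yH']; rewrite size_value in sy' yH'.
  have nty i : i < j -> nth a0 y' i = nth a0 y i by move=> ij; rewrite -ty' nth_take.
  rewrite eu2 in uw2 yb bG.
  apply: (@relaxed_link j G x wn2 Gst e2 _ _ z y' a2 b eok2 t3) => //.
  - by rewrite nty.
  - by rewrite nty.
  move=> i d iw; apply: (subsetP (hull_acons wn2 Gst d _ _ _)); last exact: yH'.
  - by move=> i' it; apply: levn; apply: leq_trans it t2.
  - by rewrite size_take_min size_value; lia.
  by apply: good_take.
exists (size (e_path e1)) => z; pose G := dom (e_time e1); pose j := size (e_path e1).
have Gst i : i < j -> stable_at a0 R i G by rewrite /j sw1; apply: levst.
have pos2 : e_pos e2 = size (e_path e2) by apply/eqP; rewrite eqn_leq pw2.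
have src2 : e_src e2 = e_path e2 by rewrite /e_src pos2 take_size.
rewrite src2 in eu1 wu1 eok1.
have lt12 : size (e_path e2) < j by rewrite -eu1.
have /set0Pn[b] := reach2 z; rewrite inE => /andP[bR bD2].
have u1 : size (e_tgt e2) < j by apply: leq_trans uw2 (ltnW lt12).
have bD1 := subsetP (dom_le _ _ _ _ tt1) _ bD2.
have path12 : take (size (e_path e2)) (value z (e_path e1)) = value z (e_path e2).
  by rewrite -value_take wu1.
have pathu : take (size (e_tgt e2)) (value z (e_path e1)) = value z (e_tgt e2).
  rewrite -value_take eu2; congr value; rewrite -[RHS]wu2 -[in RHS]wu1 take_takel //.
  by rewrite -eu2 ltnW.
(* The step of [e1] is earlier than that of [e2], so b has already passed it and is supported along
   the longer path. *)
have /domS[bG /(_ (value z (e_path e1)))] := bD1; rewrite !size_value pathu.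
move=> /(_ sw1 (ltnW u1) erefl) /supportedP[y [sy yb yw yG]].
rewrite size_value in sy yG.
exists (nth a0 y (e_pos e1)), b; split=> //.
  apply: (subsetP (front_dom z e0 esok _)); first exact/ltnW/ltnW.
  by rewrite value_take; apply: yG.
(* Since [e_path e2] is a prefix of [e_path e1], the one tuple y contains a, c and b, for every
   x. *)
move=> x; pose c := nth a0 y (size (e_path e2)).
have ywx : path_sat R (cut j [set x]) (value z (e_path e1)) y.
  by apply: path_sat_anti yw => i; apply: cut_whole.
exists c.
  apply: (@relaxed_link j G x wn1 Gst e1 _ _ z y _ c eok1 t2) => //.
    by rewrite -path12; apply: yG; apply: ltnW.
  move=> i d iw; apply: subsetP (acons_anti _ _ _ _ _ _ (cut_whole _ _)) _ _.
  exact: (subsetP (dom_acons _ _ _ _ _ (leqnn _))) (yG i iw).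
rewrite eu2 in u1 yb bG.
apply: (@relaxed_link j G x wn1 Gst e2 _ _ z (take (size (e_path e2)).+1 y) c b eok2 t3) => //.
- exact: ltnW.
- by rewrite size_takel // sy ltnS ltnW.
- by rewrite nth_take // -eu2 ltnS ltnW.
- by rewrite pos2 nth_take.
- by rewrite -path12; apply: path_sat_take; rewrite ?size_value // ltnW.
move=> i d iw; rewrite nth_take //.
have ij : i < j by apply: leq_ltn_trans lt12.
apply: (subsetP (hull_acons wn1 Gst d _ _ _)).
- by move=> i' it; apply: levn; apply: leq_trans it t2.
- by rewrite size_take_min size_value; lia.
- by apply/good_take/short_good/ltnW.
rewrite hull_small; last by rewrite size_take_min size_value; lia.
by rewrite -path12 take_takel //; apply: yG; apply: ltnW.
Qed.

(** Only the first two links exploit the relaxation. The remaining ones are walked unrelaxed,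
    following a witness of [reach]. *)
Lemma segment_crossing top es p q e0 : chain_ok top es -> p.+2 <= q < size es ->
  exists j l,
    [/\ take (q - p) (drop p es) = nth e0 es p :: l &
    forall z, exists a b, [/\ a \in front es z p, b \in reach (drop q es) z &
      forall x, segment (cut j [set x]) (nth e0 es p) l z a b]].
Proof.
move=> esok /andP[pq qe].
have [j cross] := crossing e0 esok (leq_ltn_trans pq qe).
pose l' := take (q - p.+2) (drop p.+2 es).
have pe : p.+1 < size es by lia.
exists j, (nth e0 es p.+1 :: l'); split.
  rewrite (drop_nth e0) ?(ltnW pe) // (drop_nth e0) //.
  by rewrite (_ : q - p = (q - p.+2).+2) //; lia.
move=> z; have [a [b [aF bR ab]]] := cross z.
have dropE : drop p.+2 es = l' ++ drop q es.
  by rewrite -[LHS](cat_take_drop (q - p.+2)) drop_drop subnK.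
rewrite dropE reach_cat in bR.
have [b' b'R bb'] : exists2 b', b' \in reach (drop q es) z &
    if l' is e :: l'' then segment whole e l'' z b b' else b = b'.
  case: (l') bR => [|e l''] bR; first by exists b.
  by move: bR; rewrite -segment_backward inE => /exists_inP[b' b'R bb']; exists b'.
exists a, b'; split=> // x; have [c ac cb] := ab x.
apply/existsP; exists c; rewrite ac /=; case: (l') bb' => [<- //|e l'' bb'].
apply/existsP; exists b; rewrite cb; apply: segment_anti bb' => i.
exact: cut_whole.
Qed.

End Crossing.

(** * The mighty tuple *)

Lemma holds_tuple (A : finType) r (P : {set r.-tuple A}) (t : r.-tuple A) :
  holds P t = (t \in P).
Proof.
apply/existsP/idP => [[t' /andP[tP /eqP e]]|tP]; last by exists t; rewrite tP eqxx.
by rewrite (_ : t = t') //; apply: val_inj.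
Qed.

Section ParameterizedSets.

Variable k : nat.
Local Notation A := 'I_k.
Implicit Types (z : k.-tuple A) (F : k.-tuple A -> {set A}).

Definition init_tuple (t : k.+1.-tuple A) : k.-tuple A :=
  [tuple tnth t (lift ord_max i) | i < k].

Definition param_set F : {set k.+1.-tuple A} :=
  [set t | tnth t ord_max \in F (init_tuple t)].

Lemma init_tuple_rcons z a : init_tuple [tuple of rcons z a] = z.
Proof. by apply: eq_from_tnth => i; rewrite tnth_mktuple tnth_rcons_lift. Qed.

Lemma zsect_param_set F z : zsect (param_set F) z = F z.
Proof.
apply/setP => a; rewrite inE (holds_tuple _ [tuple of rcons z a]) inE.
by rewrite tnth_rcons_max init_tuple_rcons.
Qed.

Lemma param_set_eq F F' z : param_set F = param_set F' -> F z = F' z.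
Proof. by move=> e; rewrite -zsect_param_set e zsect_param_set. Qed.

Definition glue m (z : k.-tuple A) (al : m.-tuple A) (a b : A) : (k + m + 2).-tuple A :=
  [tuple of [tuple of z ++ al] ++ [tuple a; b]].

Definition z_part m (t : (k + m + 2).-tuple A) : k.-tuple A :=
  [tuple tnth t (lshift 2 (lshift m i)) | i < k].

Definition al_part m (t : (k + m + 2).-tuple A) : m.-tuple A :=
  [tuple tnth t (lshift 2 (rshift k i)) | i < m].

Definition a_part m (t : (k + m + 2).-tuple A) : A := tnth t (rshift (k + m) ord0).
Definition b_part m (t : (k + m + 2).-tuple A) : A := tnth t (rshift (k + m) ord_max).

Lemma z_part_glue m z (al : m.-tuple A) a b : z_part (glue z al a b) = z.
Proof. by apply: eq_from_tnth => i; rewrite tnth_mktuple !tnth_lshift. Qed.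

Lemma al_part_glue m z (al : m.-tuple A) a b : al_part (glue z al a b) = al.
Proof. by apply: eq_from_tnth => i; rewrite tnth_mktuple tnth_lshift tnth_rshift. Qed.

Lemma a_part_glue m z (al : m.-tuple A) a b : a_part (glue z al a b) = a.
Proof. by rewrite /a_part tnth_rshift. Qed.

Lemma b_part_glue m z (al : m.-tuple A) a b : b_part (glue z al a b) = b.
Proof. by rewrite /b_part tnth_rshift. Qed.

Lemma mem_Qsect m (Q : {set (k + m + 2).-tuple A}) z al a b :
  ((a, b) \in Qsect Q z al) = (glue z al a b \in Q).
Proof. by rewrite inE -holds_tuple /= -catA. Qed.

End ParameterizedSets.

Section Mighty.

Variables (k n : nat) (R : {set (2 * n).+1.-tuple 'I_k}) (a0 : 'I_k).
Variables (lev : nat -> nat) (t0 : nat).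
Hypothesis levn : forall i, i < t0 -> lev i <= n.
Hypothesis levst : forall t i, t < t0 -> i < lev t ->
  stable_at a0 R i (dom a0 R lev t).
Hypothesis levne : forall t u, t < t0 -> size u <= n -> dom a0 R lev t u != set0.

Local Notation A := 'I_k.
Local Notation whole := (@whole A).
Local Notation segment := (segment R a0 lev).
Local Notation reach := (reach R a0 lev).
Local Notation front := (front R a0 lev).
Local Notation chain_ok := (chain_ok R a0 lev t0).
Local Notation dom := (dom a0 R lev).

Implicit Types (z : k.-tuple A) (e : edge k) (es l : seq (edge k)).

(** The parameter alpha has length k, which leaves room for a tuple listing all of A; there the
    relaxation disappears. *)
Definition relation j e l : {set (k + k + 2).-tuple A} :=
  [set t | segment (cut j [set x in al_part t]) e l (z_part t) (a_part t) (b_part t)].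

Lemma mem_relation j e l z al a b :
  ((a, b) \in Qsect (relation j e l) z al) = segment (cut j [set x in al]) e l z a b.
Proof. by rewrite mem_Qsect inE z_part_glue al_part_glue a_part_glue b_part_glue. Qed.

Lemma Qallall_relation j e l z a b :
  ((a, b) \in Qallall (relation j e l) z) = segment whole e l z a b.
Proof.
apply/bigcapP/idP => [H|ab al _]; last first.
  by rewrite mem_relation; apply: segment_anti ab => i; apply: cut_whole.
have := H (ord_tuple k) isT; rewrite mem_relation.
apply: segment_anti => i; rewrite /cut; case: ifP => // _.
by apply/subsetP => x _; rewrite inE; apply/tnthP; exists x; rewrite tnth_ord_tuple.
Qed.

Lemma Qall_relation j e l z a b : 0 < k ->
  (forall x, segment (cut j [set x]) e l z a b) -> (a, b) \in Qall (relation j e l) z.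
Proof.
move=> k0 H; apply/bigcapP => x _; rewrite mem_relation.
apply: segment_anti (H x) => i; apply: cut_anti; apply/subsetP => y.
by rewrite !inE => /nseqP[->].
Qed.

Lemma qdef_foldl_forward E (X : (E -> A) -> Prop) zt l a t u :
  t <= t0 -> (forall i, X (fun g => tnth (zt g) i)) -> X a ->
  (forall i e, i < size l -> well_formed lev t0 (nth e l i)) ->
  qdef R X (fun g => a g \in
    foldl (forward R a0 lev (zt g)) (dom t (value (zt g) u)) l).
Proof.
move=> tt0; elim/last_ind: l E X zt a => [|l e IH] E X zt a zX Xa wf.
  pose us := [seq (fun g => tnth (zt g) i) | i <- u] : seq (E -> A).
  apply: qdef_eq (@qdef_acons _ a0 n R lev t t E X (fun=> None) us a _ _ _ _) => //.
  - by move=> g; congr (_ \in acons _ _ _ _ _ _ _); rewrite /us /eval -map_comp.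
  - by move=> i it; apply: levn; apply: leq_trans tt0.
  by move=> i; rewrite size_map => iu; rewrite (nth_map a0).
apply: qdef_eq (@qdef_ex1 _ a0 n R E X (fun g c =>
  (c \in foldl (forward R a0 lev (zt g)) (dom t (value (zt g) u)) l) &&
  link R a0 lev whole e (zt g) c (a g)) _) => [g|].
  by rewrite -cats1 foldl_cat inE.
move=> E' X' h [//|c [|//]] hX cX _ /=.
have zX' i : X' (fun g => tnth (zt (h g)) i) by apply: (hX _ (zX i)).
apply: qdef_and.
  apply: IH => //; first exact: (cX 0).
  move=> i e' il; have := wf i e'; rewrite size_rcons nth_rcons il; apply.
  exact: ltnW.
apply: (@qdef_link k n R a0 lev t0 levn E' X' (fun=> None) (fun g => zt (h g)) _ _ e c (a \o h)) => //.
- by have := wf (size l) e; rewrite size_rcons nth_rcons ltnn eqxx; apply.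
- exact: (cX 0).
exact: hX.
Qed.

Lemma q_definable_param (F : k.-tuple A -> {set A}) :
  (forall E (X : (E -> A) -> Prop) zt a, (forall i, X (fun g => tnth (zt g) i)) ->
     X a -> qdef R X (fun g => a g \in F (zt g))) ->
  q_definable R (param_set F).
Proof.
move=> H; apply: (qdef_q_definable a0).
apply: qdef_eq (H _ _ (@init_tuple k) (fun t => tnth t ord_max) _ _).
- by move=> t; rewrite inE.
- by move=> i; exists (lift ord_max i) => t; rewrite tnth_mktuple.
by exists ord_max.
Qed.

Lemma q_definable_relation j e l :
  (forall i e', i < size (e :: l) -> well_formed lev t0 (nth e' (e :: l) i)) ->
  q_definable R (relation j e l).
Proof.
move=> wf; apply: (qdef_q_definable a0).
pose al : seq ((k + k + 2).-tuple A -> A) :=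
  [seq (fun t => tnth t (lshift 2 (rshift k i))) | i <- enum 'I_k].
apply: qdef_eq (@qdef_segment k n R a0 lev t0 levn _ _
  (fun i => if i < j then None else Some al) (@z_part k k) e l
  (@a_part k k) (@b_part k k) _ _ _ _ wf) => [t|i|i||].
- rewrite inE; apply/idP/idP; apply: segment_anti => i; rewrite /cut; case: ifP => //= _;
  by apply/subsetP => x; rewrite !inE /eval -map_comp.
- case: ifP => //= _ p; rewrite size_map -cardE card_ord => pk.
  rewrite (nth_map (Ordinal pk)) -?cardE ?card_ord //.
  by exists (lshift 2 (rshift k (nth (Ordinal pk) (enum 'I_k) p))).
- by exists (lshift 2 (lshift k i)) => t; rewrite tnth_mktuple.
- by exists (rshift (k + k) ord0).
by exists (rshift (k + k) ord_max).
Qed.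

Lemma front_nonempty top es z p : chain_ok top es -> p < size es ->
  front es z p != set0.
Proof.
move=> esok pe; have e0 : edge k by case: (es) pe.
have [t [u [/edge_okP[[_ _ tt] [sw _ _] pw _] tt0 _]]] := chain_well_formed esok e0 pe.
have := front_dom z e0 esok pe; apply: contraTneq => ->; rewrite subset0.
have tl := leq_trans tt tt0; apply: levne => //.
by rewrite size_value size_takel //; apply: leq_trans pw _; rewrite sw levn.
Qed.

Lemma mighty_of_chain top es p q z0 : 0 < k -> chain_ok top es ->
  p.+2 <= q < size es -> (forall z, front es z p = front es z q) ->
  (forall z, reach (drop p es) z = reach (drop q es) z) ->
  front es z0 p :&: reach (drop p es) z0 = set0 ->
  exists (m : nat) (Q : {set (k + m + 2).-tuple A}) (B C : {set k.+1.-tuple A}),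
    [/\ 1 <= m, mighty_tuple_III Q B C,
        q_definable R Q, q_definable R B & q_definable R C].
Proof.
move=> k0 esok pq frontE reachE disj.
have e0 : edge k by case: (es) pq => [|e0 _] //; rewrite ltn0 andbF.
have wf i e : i < size es -> well_formed lev t0 (nth e es i).
  by move=> ie; apply: (chain_well_formed esok).
have [j [l [lE cross]]] := segment_crossing levn levst e0 esok pq.
case/andP: pq => pq qe; set e := nth e0 es p in lE cross.
have dropE : drop p es = (e :: l) ++ drop q es.
  by rewrite -lE -[LHS](cat_take_drop (q - p)) drop_drop subnK //; lia.
have fwd z : [set b | [exists a in front es z p, segment whole e l z a b]] = front es z p.
  rewrite segment_forward [RHS]frontE -lE -front_split; congr front; lia.
have bwd z : [set a | [exists b in reach (drop p es) z, segment whole e l z a b]] =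
    reach (drop p es) z.
  by rewrite segment_backward [in RHS]dropE reach_cat reachE.
exists k, (relation j e l), (param_set (fun z => front es z p)),
  (param_set (reach (drop p es))); split=> //.
- split=> [z|z|z|z|].
  + rewrite !zsect_param_set; split.
      by apply: front_nonempty esok _; lia.
    (* For p = 0 no link precedes, so nonemptiness of C is read off at q, where link q - 1 records
       it. *)
    have q1 : q.-1.+1 = q by lia.
    have := chain_nth (i := q.-1) e0 esok; rewrite q1 => /(_ qe)[_ _ /(_ z)].
    by rewrite reachE; apply: contraNneq => ->; rewrite set0I.
  + rewrite !zsect_param_set -[RHS]fwd; apply/setP => b; rewrite !inE.
    by apply: eq_existsb => a; rewrite Qallall_relation.
  + rewrite !zsect_param_set -[RHS]bwd; apply/setP => b; rewrite !inE.
    by apply: eq_existsb => a; rewrite Qallall_relation andbC.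
  + have [a [b [aF bR ab]]] := cross z; apply/set0Pn; exists (a, b).
    by rewrite !zsect_param_set in_setI in_setX aF reachE bR Qall_relation.
  by exists z0; rewrite !zsect_param_set.
- apply: q_definable_relation => i e'; rewrite -lE size_take_min => ilt.
  by rewrite nth_take ?nth_drop; [apply: wf|]; move: ilt; rewrite size_drop; lia.
- apply: q_definable_param => E X zt a zX Xa.
  pose e1 := nth e0 es 0; have es0 : 0 < size es by lia.
  have frontQ g : front es g p = foldl (forward R a0 lev g)
      (dom (e_time e1) (value g (e_src e1))) (take p es).
    by rewrite /e1; case: (es) es0.
  have [t [u [/edge_okP[[_ _ tt] _ _ _] tt0 _]]] := wf 0 e0 es0.
  apply: qdef_eq (@qdef_foldl_forward E X zt (take p es) a (e_time e1) (e_src e1) _ zX Xa _).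
  - by move=> g; rewrite -frontQ.
  - exact: leq_trans (ltnW tt) tt0.
  by move=> i e' ip; rewrite nth_take; [apply: wf|]; move: ip; rewrite size_take_min; lia.
apply: q_definable_param => E X zt a zX Xa.
apply: (@qdef_reach k n R a0 lev t0 levn E X zt (drop p es) a zX Xa) => i e'.
by rewrite size_drop nth_drop => ie; apply: wf; lia.
Qed.

End Mighty.

(** * Reductions from stable domains, and iteration of the chain *)

Section Reduction.

Variables (n k : nat) (R : {set (2 * n).+1.-tuple 'I_k}) (a0 : 'I_k).
Local Notation A := 'I_k.

(** At parameter z the constraint named s is, after renaming labels, the one named [value z s] at
    the identity, so stability of [G] covers every parameter. *)
Lemma stable_reduction (G : seq A -> {set A}) :
  (forall i, i <= n -> stable_at a0 R i G) ->
  (forall u, size u <= n -> G u != set0) ->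
  exists D : n.-bseq A -> {set k.+1.-tuple A},
    nonempty_reduction D /\ one_consistent (IR R) D.
Proof.
move=> Gst Gne; exists (fun s => param_set (fun z => G (value z s))).
split=> [s z|z s i].
  by rewrite zsect_param_set Gne // size_value size_bseq.
have DE j : zsect (param_set (fun z => G (value z (tnth (cscope (IR R s)) j)))) z
    = G (take j (value z s)).
  rewrite zsect_param_set (scope_nth R j z).1 bwordK ?value_take //.
  by rewrite size_take_min (leq_trans (geq_minr _ _)) ?size_bseq.
apply/setP => a; apply/imsetP/idP => [[t]|].
  by rewrite inE => /andP[_ /forallP tD] ->; apply: tD.
rewrite DE => aG; have iw : i <= size s by rewrite -ltnS; apply: ltn_ord.
have /supportedP[y [sy ya /path_satP yw yG]] :
    supported a0 R (@whole A) (fun=> G) (value z s) i a.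
  by apply: (Gst (size s)) => //; rewrite ?size_bseq ?size_value.
rewrite size_value in sy yw yG; have sy' : size y == (size s).+1 by apply/eqP.
have yR := yw _ (leqnn _); rewrite -{1}sy take_size -{2}(size_value z) take_size in yR.
exists (Tuple sy'); last by rewrite (tnth_nth a0).
rewrite inE (scope_nth R i z).2 yR; apply/forallP => j.
by rewrite DE (tnth_nth a0); apply: yG; rewrite -ltnS; apply: ltn_ord.
Qed.

Lemma chain_iter lev t0 top es d : chain_ok R a0 lev t0 top es ->
  pending R a0 lev t0 top es d ->
  exists top' es', [/\ chain_ok R a0 lev t0 top' es',
    pending R a0 lev t0 top' es' 0 & size es' = size es + d].
Proof.
elim: d top es => [|d IH] top es esok pend; first by exists top, es; rewrite addn0.
have [z1 [e [ok1 pend1]]] := chain_step esok pend.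
have [top' [es' [ok' pend' s']]] := IH _ _ ok1 pend1; exists top', es'; split=> //.
by rewrite s' /= size_map addSnnS.
Qed.

End Reduction.

(** * Pigeonhole and the final count *)

Lemma card_set_of (T : finType) : #|{: {set T}}| = 2 ^ #|T|.
Proof. by rewrite -[LHS]cardsT -powersetT card_powerset cardsT. Qed.

(* The pairs (B, C) and (B, ~: C) are pairwise distinct, so at most half of all
   pairs of sets can be values. *)
Lemma disjoint_pair_collision (T : finType) N (B C : nat -> {set T}) (P : pred T) :
  (2 ^ #|T|) ^ 2 <= N.*2 ->
  (forall i, i < N -> exists2 t, P t & t \in B i) ->
  (forall i t, i < N -> P t -> t \in B i -> t \notin C i) ->
  exists i j, [/\ i < j, j < N, B i = B j & C i = C j].
Proof.
move=> TN Bne disj.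
case: (boolP [exists i : 'I_N, exists j : 'I_N,
               [&& i < j, B i == B j & C i == C j]]) => [|/existsPn inj].
  case/existsP => i /existsP[j /and3P[ij /eqP eB /eqP eC]].
  by exists i, j; split.
(* [None] contributes one more pair, with empty first component, so that 2N + 1 distinct pairs would
   have to fit among at most 2N. *)
pose f (o : option ('I_N * bool)) : {set T} * {set T} :=
  if o is Some (i, b) then (B i, if b then C i else ~: C i) else (set0, set0).
have BC_inj (i j : 'I_N) : B i = B j -> C i = C j -> i = j.
  have lt_false (i' j' : 'I_N) : i' < j' -> B i' = B j' -> C i' = C j' -> False.
    move=> ij eB eC; have /existsPn/(_ j') := inj i'.
    by rewrite ij eB eC !eqxx.
  move=> eB eC; apply: val_inj; case: (ltngtP i j) => // h.
    by case: (lt_false i j).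
  by case: (lt_false j i).
have mixed (i j : 'I_N) : B i = B j -> C i = ~: C j -> False.
  move=> eB eC; have [t Pt tB] := Bne i (ltn_ord i).
  have := disj i t (ltn_ord i) Pt tB; rewrite eC inE negbK.
  by rewrite eB in tB; apply/negP; apply: disj.
have ne (i : 'I_N) : B i != set0.
  by have [t _ tB] := Bne i (ltn_ord i); apply/set0Pn; exists t.
have f_inj : injective f.
  case=> [[i []]|] [[j []]|] //= [eB].
  - by move/(BC_inj i j eB) ->.
  - by case/(mixed i j eB).
  - by move=> _; case/eqP: (ne i).
  - by move/esym/(mixed j i (esym eB)).
  - by move/setC_inj/(BC_inj i j eB) ->.
  - by move=> _; case/eqP: (ne i).
  - by move=> _; case/eqP: (ne j).
  - by move=> _; case/eqP: (ne j).
have := leq_card f f_inj.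
rewrite card_option !card_prod card_ord card_bool !card_set_of; lia.
Qed.

Lemma var_bound_lt n k d : 1 < n * k -> var_bound n k d < (n * k) ^ d.+1.
Proof.
move=> c1; elim: d => [|d IH]; first by rewrite expn1.
rewrite /= [X in _ < X]expnS -addn2.
apply: leq_trans (_ : n * k * (var_bound n k d).+1 <= _); last by rewrite leq_mul2l IH orbT.
by rewrite mulnS addn2 addnC -addn2 leq_add2l.
Qed.

(** For nk = 1 the bound is a single variable and the geometric estimate fails. Over one value, the
    root constraint either holds, and then all constraints do, or is unsatisfiable with its one
    variable. *)
Lemma trivial_case (R : {set (2 * 1).+1.-tuple 'I_1}) :
  (exists D : 1.-bseq 'I_1 -> {set 2.-tuple 'I_1},
     nonempty_reduction D /\ one_consistent (IR R) D)
  \/ (exists J : {set 1.-bseq 'I_1}, #|inst_vars (IR R) J| <= 1 /\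
        exists z : 1.-tuple 'I_1,
          ~ exists f : 1.-bseq 'I_1 -> 'I_1, is_solution (IR R) J z f).
Proof.
pose a0 : 'I_1 := ord0.
have seqE (s : seq 'I_1) : s = nseq (size s) a0.
  by apply: (@eq_from_nth _ a0) => [|i _]; rewrite ?size_nseq // !ord1.
case: (boolP (rSR R (@whole _) 0 [:: a0] [::])) => [S0|S0].
  left; apply: (@stable_reduction 1 1 R a0 (fun=> setT)) => [i i1 w p a sw pw _|u _].
    apply/supportedP; exists (nseq i.+1 a0); split.
    - by rewrite size_nseq sw.
    - by rewrite !ord1.
    - apply/path_satP => j; rewrite sw => ji; rewrite (seqE (take _ w)) (seqE (take _ (nseq _ _))).
      rewrite !size_takel ?size_nseq ?sw //; case: j ji => [_|[|j]] //= ji; last by lia.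
      move: S0 => /forall_inP/(_ a0); rewrite inE => /(_ isT)/existsP[y].
      move=> /forall_inP/(_ a0); rewrite inE => /(_ isT)/existsP[v] /=.
      by rewrite tuple0 /= (ord1 y).
    by move=> j _; rewrite inE.
  by apply/set0Pn; exists a0; rewrite inE.
right; exists [set bword 1 [::]]; split.
  apply: leq_trans (_ : #|[set bword 1 ([::] : seq 'I_1)]| <= 1); last by rewrite cards1.
  rewrite /inst_vars big_set1.
  apply/subset_leq_card/subsetP => v; rewrite !inE.
  by move=> /(@scope_vars 1 1 R [::] v isT)[j _ ->].
exists (ord_tuple 1) => -[f sol]; case/negP: S0.
have := @solution_constraint 1 1 R a0 _ _ _ [::] sol isT.
by rewrite inE eqxx /= => /(_ isT); rewrite !ord1.
Qed.

Theorem theorem18 (n k : nat) (hk : 0 < k) (hn : 1 <= n)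
    (R : {set (2 * n).+1.-tuple 'I_k}) :
  (exists D : n.-bseq 'I_k -> {set k.+1.-tuple 'I_k},
     nonempty_reduction D /\ one_consistent (IR R) D)
  \/ (exists J : {set n.-bseq 'I_k},
        #|inst_vars (IR R) J| <= (n * k) ^ (2 ^ (2 * k ^ k.+1)) /\
        exists z : k.-tuple 'I_k,
          ~ exists f : n.-bseq 'I_k -> 'I_k, is_solution (IR R) J z f)
  \/ (exists (m : nat) (Q : {set (k + m + 2).-tuple 'I_k})
        (B C : {set k.+1.-tuple 'I_k}),
        [/\ 1 <= m, mighty_tuple_III Q B C,
            q_definable R Q, q_definable R B & q_definable R C]).
Proof.
have [nk1|nk1] := leqP (n * k) 1.
  have [n1 k1] : n = 1 /\ k = 1 by split; nia.
  subst n k; case: (trivial_case R) => [H|[J [Jc H]]]; first by left.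
  by right; left; exists J; rewrite muln1 exp1n.
pose a0 : 'I_k := Ordinal hk.
have [lev [T [[levn levst levne] [[Gst Gne]|[u un uD]]]]] := schedule_exists a0 R.
  by left; apply: stable_reduction Gst Gne.
right; set N := 2 ^ _.
have NE : N = (2 ^ (2 * k ^ k.+1).-1).*2.
  by rewrite -mul2n -expnS prednK // muln_gt0 expn_gt0 hk.
set N2 := 2 ^ _ in NE; have N20 : 0 < N2 by rewrite expn_gt0.
case: (boolP [exists s : n.-bseq 'I_k,
    acons a0 R (@whole _) lev T N.-1 s == set0]) => [/existsP[s /eqP sP]|/existsPn ne].
  left; have [J [Jc JP]] := @small_derivation n k R a0 lev T N.-1 s levn (size_bseq s).
  exists J; split; last first.
    by exists (ord_tuple k) => -[f /JP]; rewrite sP inE.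
  apply: leq_trans (_ : var_bound n k N.-1 <= _).
    by apply: leq_trans Jc; apply/subset_leq_card/subsetUr.
  by have := var_bound_lt N.-1 nk1; rewrite prednK; [lia | rewrite NE; lia].
right; have pend : pending R a0 lev T u [::] N.-1.
  split=> [z|]; last by exists (ord_tuple k); rewrite /= value_id uD setI0.
  have sz : size (value z u) <= n by rewrite size_value.
  by rewrite setTI; apply: (ne (Bseq sz)).
have nilok : chain_ok R a0 lev T u [::] by [].
have [top [es [esok [live [z0 dead]] ses]]] := chain_iter nilok pend.
have sesN : size es = N.-1 by rewrite ses.
have front0 : front R a0 lev es z0 0 :&: reach R a0 lev es z0 = set0.
  move: dead; rewrite setIC; case: (es) sesN => [|e es'] _ //=.
  by rewrite set0I.
have disj i : i < size es ->
    front R a0 lev es z0 i :&: reach R a0 lev (drop i es) z0 = set0.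
  by move=> ie; apply: front_reach front0; apply: ltnW.
(* Even positions keep any two chosen places at least two links apart, as crossing requires. All N2
   = N/2 of them lie within the N - 1 links. *)
pose B i := param_set (fun z => front R a0 lev es z i.*2).
pose C i := param_set (reach R a0 lev (drop i.*2 es)).
have lt2 i : i < N2 -> i.*2 < size es by rewrite sesN NE; lia.
have [||| i [j [ij jN eB eC]]] :=
  @disjoint_pair_collision _ N2 B C (fun t => init_tuple t == z0).
- by rewrite card_tuple card_ord -expnM mulnC -NE.
- move=> i /lt2 ie; have /set0Pn[b bF] := front_nonempty levn levne z0 esok ie.
  exists [tuple of rcons z0 b]; first by rewrite init_tuple_rcons.
  by rewrite inE init_tuple_rcons tnth_rcons_max.
- move=> i t /lt2 ie /eqP tz; rewrite !inE tz => tF; apply/negP => tR.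
  by have := in_set0 (tnth t ord_max); rewrite -(disj _ ie) inE tF tR.
apply: (@mighty_of_chain k n R a0 lev T levn levst levne top es i.*2 j.*2 z0) => //.
- by rewrite -doubleS leq_double ij lt2.
- by move=> z; apply: (param_set_eq _ eB).
- by move=> z; apply: (param_set_eq _ eC).
by apply/disj/lt2; apply: ltn_trans jN.
Qed.
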